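(* Let $F$ be a field with a nontrivial valuation $v$ and valuation domain $O_v$. Let $R$ be a torsion-free $O_v$-algebra such that $[R\otimes_{O_v}F:F]<\infty$. Assume that there exists a $v$-quasi-valuation $w$ on $R$ (with respect to $O_v$) such that $w(1_R)=0$, $w(x)\ne\infty$ for all nonzero $x\in R$, and $M_w$ is cancellative. Let $W$ denote the natural extension of $w$ to $R\otimes_{O_v}F$, and let $\mathcal C$ be a maximal chain (with respect to containment) in $\operatorname{Spec}(O_W)$. Then the map $Q\mapsto Q\cap O_v$ is a bijective order preserving correspondence from $\mathcal C$ to $\operatorname{Spec}(O_v)$.
   Context: Rings are associative with $1$, not necessarily commutative; $\operatorname{Spec}$ denotes the set of prime (two-sided) ideals. $\Gamma_v$ is the value group of $v$, $O_v=\{x\in F: v(x)\ge0\}$. An $O_v$-algebra is a ring $R$ with a unitary ring homomorphism $O_v\to Z(R)$, $c\mapsto c\cdot 1_R$; it is torsion-free if $cr=0$ with $c\in O_v$, $r\in R$ implies $c=0$ or $r=0$. A quasi-valuation on a ring $R$ is a map $w:R\to M\cup\{\infty\}$, where $M$ is a totally ordered abelian monoid and $\infty$ is an adjoined element greater than all of $M$, such that $w(0)=\infty$, $w(xy)\ge w(x)+w(y)$ and $w(x+y)\ge\min\{w(x),w(y)\}$ for all $x,y\in R$. It is a $v$-quasi-valuation with respect to $O_v$ if (with $M$ containing $\Gamma_v$ as an ordered submonoid) $w(cx)=v(c)+w(x)$ for all $c\in O_v$, $x\in R$. $M_w$ is the submonoid of $M$ generated by $w(R\setminus\{0\})$. The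 natural extension of $w$ is the quasi-valuation $W$ on $R\otimes_{O_v}F$ given by $W(r\otimes\frac1b)=w(r)-v(b)$ for $r\in R$, $0\ne b\in O_v$ (every element of $R\otimes_{O_v}F$ has the form $r\otimes\frac1b$). $O_W=\{x\in R\otimes_{O_v}F: W(x)\ge0\}$, which is an $O_v$-algebra. For an ideal $Q$ of an $O_v$-algebra $T$, $Q\cap O_v=\{c\in O_v: c\cdot 1_T\in Q\}$. *)

(* Defs.v *)
From HB Require Import structures.
From mathcomp Require Import all_boot all_order all_algebra.
From mathcomp Require Import boolp classical_sets functions.

Set Implicit Arguments.
Unset Strict Implicit.
Unset Printing Implicit Defensive.

Import Order.TTheory GRing.Theory Num.Theory.
Import quotient.
Local Open Scope ring_scope.
Local Open Scope classical_set_scope.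

Declare Scope omon_scope.
Delimit Scope omon_scope with OM.
Local Open Scope omon_scope.

(* The ring_display orders of the library cannot be joined to nmodType below
   porderZmodType, so the order is a separate operation. *)
HB.mixin Record isOrdNmodule M of GRing.Nmodule M := {
  ole : rel M;
  ole_anti : antisymmetric ole;
  ole_trans : transitive ole;
  ole_total : total ole;
  oleD2r : forall z x y : M, ole x y -> ole (x + z) (y + z)
}.

#[short(type="ordNmodType")]
HB.structure Definition OrdNmodule := {M of GRing.Nmodule M & isOrdNmodule M}.

#[short(type="ordZmodType")]
HB.structure Definition OrdZmodule := {G of OrdNmodule G & GRing.Zmodule G}.

Notation "x <=o y" := (ole x y) (at level 70, no associativity) : omon_scope.

Definition omin (M : ordNmodType) (x y : M) : M := if x <=o y then x else y.

Lemma ole_refl (M : ordNmodType) : reflexive (@ole M).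
Proof. by move=> x; have := ole_total x x; rewrite orbb. Qed.

Lemma oleD (M : ordNmodType) (x y z t : M) :
  x <=o y -> z <=o t -> x + z <=o y + t.
Proof.
move=> xy zt; apply: ole_trans (oleD2r z _ _ xy) _.
by rewrite ![y + _]addrC oleD2r.
Qed.

Lemma ole_omin (M : ordNmodType) (z x y : M) :
  (z <=o omin x y) = (z <=o x) && (z <=o y).
Proof.
rewrite /omin; case: ifP => xy.
  by case zx: (z <=o x) => //=; rewrite (ole_trans _ _ _ zx xy).
have yx : y <=o x by have := ole_total x y; rewrite xy.
by case zy: (z <=o y); rewrite ?andbF // (ole_trans _ _ _ zy yx).
Qed.

Lemma omin_add2r (M : ordNmodType) (z x y : M) :
  omin x y + z = omin (x + z) (y + z).
Proof.
rewrite /omin; case: ifP => xy; first by rewrite oleD2r.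
have yx : y <=o x by have := ole_total x y; rewrite xy.
case: ifP => // xyz; apply: ole_anti; rewrite xyz andbT.
exact: oleD2r.
Qed.

Record ordEmbedding (G M : ordNmodType) := OrdEmbedding {
  emb_fun :> {additive G -> M};
  emb_mono : {mono emb_fun : x y / x <=o y}
}.

Definition withtop (M : Type) : Type := option M.
Definition fin (M : Type) (x : M) : withtop M := Some x.
Definition oo {M : Type} : withtop M := None.

Section WithTop.
Variable M : ordNmodType.
Implicit Types x y z : withtop M.

Definition addtop x y : withtop M :=
  if x is Some a then if y is Some b then fin (a + b) else oo else oo.

Definition letop x y : bool :=
  if y is Some b then if x is Some a then a <=o b else false else true.

HB.instance Definition _ := Choice.copy (withtop M) (option M).

Fact addtopA : associative addtop.
Proof. by case=> [a|] [b|] [c|] //=; rewrite /fin addrA. Qed.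
Fact addtopC : commutative addtop.
Proof. by case=> [a|] [b|] //=; rewrite /fin addrC. Qed.
Fact addtop0 : left_id (fin 0) addtop.
Proof. by case=> [a|] //=; rewrite /fin add0r. Qed.

HB.instance Definition _ :=
  GRing.isNmodule.Build (withtop M) addtopA addtopC addtop0.

Fact letop_anti : antisymmetric letop.
Proof. by case=> [a|] [b|] //= /ole_anti ->. Qed.
Fact letop_trans : transitive letop.
Proof. by case=> [a|] [b|] [c|] //=; exact: ole_trans. Qed.
Fact letop_total : total letop.
Proof. by case=> [a|] [b|] //=; exact: ole_total. Qed.
Fact letopD2r z x y : letop x y -> letop (x + z) (y + z).
Proof. by case: z x y => [c|] [a|] [b|] //=; exact: oleD2r. Qed.

HB.instance Definition _ := isOrdNmodule.Build (withtop M)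
  letop_anti letop_trans letop_total letopD2r.

Lemma add_fin (a b : M) : fin a + fin b = fin (a + b). Proof. by []. Qed.
Lemma le_fin (a b : M) : (fin a <=o fin b) = (a <=o b). Proof. by []. Qed.
Lemma fin0 : fin (0 : M) = 0. Proof. by []. Qed.

End WithTop.

Section Lift.
Variables (G : ordZmodType) (M : ordNmodType) (iota : ordEmbedding G M).

Definition embtop (g : withtop G) : withtop M := omap iota g.

(* m - g; the value at g = oo is never used *)
Definition subtop (m : withtop M) (g : withtop G) : withtop M :=
  if g is Some a then m + fin (iota (- a)) else oo.

Lemma embtopD g h : embtop (g + h) = embtop g + embtop h.
Proof. by case: g h => [a|] [b|] //=; rewrite add_fin -raddfD. Qed.

Lemma embtop_ge0 g : 0 <=o g -> 0 <=o embtop g.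
Proof.
by case: g => [a|] //=; rewrite -!fin0 !le_fin -(raddf0 iota) emb_mono.
Qed.

Lemma subtopE m a : subtop m (fin a) = m + fin (iota (- a)). Proof. by []. Qed.

Lemma embtopK a : fin (iota a) + fin (iota (- a)) = 0.
Proof. by rewrite add_fin -raddfD subrr raddf0. Qed.

Lemma embtop_shift m a b :
  subtop (embtop (fin a) + m) (fin (a + b)) = subtop m (fin b).
Proof.
rewrite !subtopE opprD raddfD -add_fin addrAC addrA embtopK add0r.
by rewrite addrC.
Qed.

End Lift.

Record valuation (F : fieldType) (G : ordZmodType) := Valuation {
  val_fun :> F -> withtop G;
  val_eq_oo : forall x, val_fun x = oo <-> x = 0;
  valM : forall x y, val_fun (x * y) = val_fun x + val_fun y;
  valD : forall x y, omin (val_fun x) (val_fun y) <=o val_fun (x + y);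
  (* G is the value group, not just a group containing it *)
  val_surj : forall g : G, exists x, val_fun x = fin g
}.

(* F as an O_v-algebra: v must occur in the type for instances to find it. *)
Definition fieldOf (F : fieldType) (G : ordZmodType) (v : valuation F G) : Type :=
  F.

Section ValuationRing.
Variables (F : fieldType) (G : ordZmodType) (v : valuation F G).

Lemma val0 : v 0 = oo. Proof. exact/val_eq_oo. Qed.

Lemma val_fin x : x != 0 -> exists g, v x = fin g.
Proof.
case E: (v x) => [g|]; first by exists g.
by move/val_eq_oo: E => ->; rewrite eqxx.
Qed.

Lemma val1 : v 1 = 0.
Proof.
have [g vg] := val_fin (oner_neq0 F).
have := valM v 1 1; rewrite mulr1 vg add_fin => -[] /eqP.
by rewrite -subr_eq0 opprD addNKr oppr_eq0 => /eqP ->.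
Qed.

Lemma valV x g : v x = fin g -> v x^-1 = fin (- g).
Proof.
move=> vx; have x0 : x != 0 by apply/eqP => x0; move: vx; rewrite x0 val0.
have [h vh] : exists h, v x^-1 = fin h by apply: val_fin; rewrite invr_eq0.
have := valM v x x^-1; rewrite mulfV // val1 vx vh add_fin -fin0 => -[] /eqP.
by rewrite eq_sym addrC addr_eq0 => /eqP ->.
Qed.

Lemma ofin_addrr (g : G) : g + g = 0 -> g = 0.
Proof.
move=> gg; apply: ole_anti.
by case/orP: (ole_total g 0) => le; have:= oleD2r g _ _ le; rewrite gg add0r => ->; rewrite le.
Qed.

Lemma valN1 : v (- 1) = 0.
Proof.
have [|g vg] := @val_fin (- 1); first by rewrite oppr_eq0 oner_neq0.
have := valM v (- 1) (- 1); rewrite mulrNN mulr1 val1 vg add_fin -fin0.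
by case=> /esym /ofin_addrr ->.
Qed.

Definition Ov_pred : {pred F} := [pred x | 0 <=o v x].

Fact Ov_subring : subring_closed Ov_pred.
Proof.
split=> [|x y|x y]; rewrite !inE.
- by rewrite val1 ole_refl.
- move=> vx vy; apply: ole_trans (valD v x (- y)).
  by rewrite ole_omin vx -mulN1r valM valN1 add0r.
- by move=> vx vy; rewrite valM; have := oleD vx vy; rewrite add0r.
Qed.

Record Ov := MkOv { Ov_val : F; _ : Ov_val \in Ov_pred }.

HB.instance Definition _ := [isSub for Ov_val].
HB.instance Definition _ := [Choice of Ov by <:].
HB.instance Definition _ :=
  GRing.SubChoice_isSubComNzRing.Build F Ov_pred Ov Ov_subring.

Lemma Ov_ge0 (c : Ov) : 0 <=o v (\val c). Proof. by case: c. Qed.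

Lemma Ov_val_eq0 (c : Ov) : (\val c == 0) = (c == 0).
Proof. by rewrite -[c == 0](inj_eq val_inj) raddf0. Qed.

Lemma Ov_valN1 : \val (- 1 : Ov) = - 1.
Proof. by rewrite raddfN; congr (- _); exact: rmorph1. Qed.

Lemma Ov_fin (c : Ov) : c != 0 -> exists g, v (\val c) = fin g.
Proof. by rewrite -Ov_val_eq0; exact: val_fin. Qed.

Local Notation FO := (fieldOf v).
HB.instance Definition _ := GRing.Field.copy FO F.

Definition FO_scale (c : Ov) (x : FO) : FO := \val c * (x : F).

Fact FO_scaleA (a b : Ov) x : FO_scale a (FO_scale b x) = FO_scale (a * b) x.
Proof. by rewrite /FO_scale rmorphM mulrA. Qed.
Fact FO_scale1 : left_id 1 FO_scale.
Proof. by move=> x; rewrite /FO_scale rmorph1 mul1r. Qed.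
Fact FO_scaleDr : right_distributive FO_scale +%R.
Proof. by move=> c x y; rewrite /FO_scale mulrDr. Qed.
Fact FO_scaleDl x : {morph FO_scale^~ x : a b / a + b}.
Proof. by move=> a b; rewrite /FO_scale rmorphD mulrDl. Qed.

HB.instance Definition _ := GRing.Zmodule_isLmodule.Build Ov FO
  FO_scaleA FO_scale1 FO_scaleDr FO_scaleDl.

Fact FO_scaleAl (c : Ov) (x y : FO) : c *: (x * y) = (c *: x) * y.
Proof. exact: mulrA. Qed.

HB.instance Definition _ := GRing.Lmodule_isLalgebra.Build Ov FO FO_scaleAl.
HB.instance Definition _ := GRing.Lalgebra_isComAlgebra.Build Ov FO.

Lemma FO_scaleE (c : Ov) (x : FO) : c *: x = (\val c : FO) * x.
Proof. by []. Qed.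

End ValuationRing.

Section Tensor.
Variables (A : comNzRingType) (R : algType A) (S : comAlgType A).

(* A list of pairs stands for the sum of the tensors of its members. The zero
   rule is needed because formal sums have no inverses. *)
Inductive tens_eq : seq (R * S) -> seq (R * S) -> Prop :=
| tens_eq_refl s : tens_eq s s
| tens_eq_sym s t : tens_eq s t -> tens_eq t s
| tens_eq_trans s t u : tens_eq s t -> tens_eq t u -> tens_eq s u
| tens_eq_cat s s' t t' :
    tens_eq s s' -> tens_eq t t' -> tens_eq (s ++ t) (s' ++ t')
| tens_eq_catC s t : tens_eq (s ++ t) (t ++ s)
| tens_eq_0 x : tens_eq [:: (0, x)] [::]
| tens_eq_Dl r r' x : tens_eq [:: (r + r', x)] [:: (r, x); (r', x)]
| tens_eq_Dr r x x' : tens_eq [:: (r, x + x')] [:: (r, x); (r, x')]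
| tens_eq_Z a r x : tens_eq [:: (a *: r, x)] [:: (r, a *: x)].

Definition tens_rel : rel (seq (R * S)) := fun s t => `[< tens_eq s t >].

Fact tens_rel_refl : reflexive tens_rel.
Proof. by move=> s; apply/asboolP; exact: tens_eq_refl. Qed.
Fact tens_rel_sym : symmetric tens_rel.
Proof. by move=> s t; apply/asboolP/asboolP; exact: tens_eq_sym. Qed.
Fact tens_rel_trans : transitive tens_rel.
Proof.
by move=> t s u /asboolP st /asboolP tu; apply/asboolP/(tens_eq_trans st).
Qed.

Canonical tens_equiv := EquivRel tens_rel tens_rel_refl tens_rel_sym tens_rel_trans.

Definition tensor : Type := {eq_quot tens_equiv}%qT.
HB.instance Definition _ := Choice.on tensor.
HB.instance Definition _ := EqQuotient.on tensor.

Definition class_of (s : seq (R * S)) : tensor := (\pi_tensor s)%qT.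

Lemma class_ofP s t : class_of s = class_of t <-> tens_eq s t.
Proof.
by split=> [/eqmodP/asboolP|st] //; apply/eqmodP/asboolP.
Qed.

Lemma class_ofK (x : tensor) : class_of (repr x) = x.
Proof. exact: reprK. Qed.

Definition tadd (x y : tensor) : tensor := class_of (repr x ++ repr y).
Definition topp (x : tensor) : tensor :=
  class_of [seq (- p.1, p.2) | p <- repr x].

Lemma repr_class s : tens_eq (repr (class_of s)) s.
Proof. by apply/class_ofP; rewrite class_ofK. Qed.

Lemma class_cat s t : class_of (s ++ t) = tadd (class_of s) (class_of t).
Proof. by apply/class_ofP/tens_eq_sym/tens_eq_cat; exact: repr_class. Qed.

Lemma tensor_quotP (P : tensor -> Prop) : (forall s, P (class_of s)) -> forall x, P x.
Proof. by move=> Ps x; rewrite -(class_ofK x). Qed.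

Fact taddA : associative tadd.
Proof.
elim/tensor_quotP=> s; elim/tensor_quotP=> t; elim/tensor_quotP=> u.
by rewrite -!class_cat catA.
Qed.
Fact taddC : commutative tadd.
Proof.
elim/tensor_quotP=> s; elim/tensor_quotP=> t; rewrite -!class_cat.
exact/class_ofP/tens_eq_catC.
Qed.
Fact tadd0 : left_id (class_of [::]) tadd.
Proof. by elim/tensor_quotP=> s; rewrite -class_cat. Qed.
Fact taddN : left_inverse (class_of [::]) topp tadd.
Proof.
move=> x; rewrite -{2}(class_ofK x) /topp -class_cat.
elim: (repr x) => //= -[r y] s IHs.
rewrite -cat1s -[(r, y) :: s]cat1s catA !class_cat.
rewrite taddA -(taddA _ _ (class_of [:: (r, y)])).
rewrite (taddC (class_of _) (class_of [:: (r, y)])) taddA -taddA.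
rewrite -class_cat (_ : tadd _ (class_of s) = class_of [::]); last first.
  by rewrite -IHs class_cat.
rewrite taddC tadd0; apply/class_ofP.
apply: tens_eq_trans (tens_eq_0 y).
by rewrite -[0](addNr r); apply/tens_eq_sym/tens_eq_Dl.
Qed.

HB.instance Definition _ := GRing.isZmodule.Build tensor taddA taddC tadd0 taddN.

Definition tens (r : R) (x : S) : tensor := class_of [:: (r, x)].

Lemma class_nil : class_of [::] = 0. Proof. by []. Qed.
Lemma class_catD s t : class_of (s ++ t) = class_of s + class_of t.
Proof. exact: class_cat. Qed.
Lemma class_sum s : class_of s = \sum_(p <- s) tens p.1 p.2.
Proof.
elim: s => [|[r x] s IHs]; first by rewrite big_nil.
by rewrite big_cons -IHs -class_catD.
Qed.

Lemma tens_ind (P : tensor -> Prop) :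
  P 0 -> (forall r x, P (tens r x)) -> (forall x y, P x -> P y -> P (x + y)) ->
  forall x, P x.
Proof.
move=> P0 Pt PD; elim/tensor_quotP=> s; rewrite class_sum.
by apply: big_ind.
Qed.

Lemma tensDl r r' x : tens (r + r') x = tens r x + tens r' x.
Proof. by rewrite -class_catD; apply/class_ofP; exact: tens_eq_Dl. Qed.
Lemma tensDr r x x' : tens r (x + x') = tens r x + tens r x'.
Proof. by rewrite -class_catD; apply/class_ofP; exact: tens_eq_Dr. Qed.
Lemma tensZ a r x : tens (a *: r) x = tens r (a *: x).
Proof. by apply/class_ofP; exact: tens_eq_Z. Qed.
Lemma tens0l x : tens 0 x = 0.
Proof. by rewrite -class_nil; apply/class_ofP; exact: tens_eq_0. Qed.

Section Lift.
Variables (V : zmodType) (f : R -> S -> V).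
Hypotheses (fDl : forall r r' x, f (r + r') x = f r x + f r' x)
  (fDr : forall r x x', f r (x + x') = f r x + f r x')
  (fZ : forall a r x, f (a *: r) x = f r (a *: x)).

Definition tens_lift (x : tensor) : V := \sum_(p <- repr x) f p.1 p.2.

Lemma tens_lift_class s : tens_lift (class_of s) = \sum_(p <- s) f p.1 p.2.
Proof.
suff H t u : tens_eq t u -> \sum_(p <- t) f p.1 p.2 = \sum_(p <- u) f p.1 p.2.
  exact/H/repr_class.
elim=> {s t u} //.
- by move=> s' t u _ -> _ ->.
- by move=> s s' t t' _ IHs _ IHt; rewrite !big_cat IHs IHt.
- by move=> s t; rewrite !big_cat /= addrC.
- move=> x; rewrite big_seq1 big_nil /=.
  by have /eqP := fDl 0 0 x; rewrite addr0 -subr_eq0 opprD addNKr oppr_eq0 => /eqP.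
- by move=> r r' x; rewrite !big_cons big_nil !addr0 /= fDl.
- by move=> r x x'; rewrite !big_cons big_nil !addr0 /= fDr.
- by move=> a r x; rewrite !big_seq1 /= fZ.
Qed.

Lemma tens_lift_tens r x : tens_lift (tens r x) = f r x.
Proof. by rewrite tens_lift_class big_seq1. Qed.

Lemma tens_liftD : {morph tens_lift : x y / x + y}.
Proof.
elim/tensor_quotP=> s; elim/tensor_quotP=> t.
by rewrite -class_catD !tens_lift_class big_cat.
Qed.
End Lift.

Definition tmul (x y : tensor) : tensor :=
  tens_lift (fun r a => tens_lift (fun s b => tens (r * s) (a * b)) y) x.

Let mDl r a (s s' : R) b :
  tens (r * (s + s')) (a * b) = tens (r * s) (a * b) + tens (r * s') (a * b).
Proof. by rewrite mulrDr tensDl. Qed.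
Let mDr r a (s : R) b b' :
  tens (r * s) (a * (b + b')) = tens (r * s) (a * b) + tens (r * s) (a * b').
Proof. by rewrite mulrDr tensDr. Qed.
Let mZ r a c (s : R) b : tens (r * (c *: s)) (a * b) = tens (r * s) (a * (c *: b)).
Proof. by rewrite -!scalerAr tensZ. Qed.

Let tmul_row y r a := tens_lift (fun s b => tens (r * s) (a * b)) y.

Let rowDl y r r' a : tmul_row y (r + r') a = tmul_row y r a + tmul_row y r' a.
Proof.
rewrite /tmul_row /tens_lift -big_split /=; apply: eq_bigr => p _.
by rewrite mulrDl tensDl.
Qed.
Let rowDr y r a a' : tmul_row y r (a + a') = tmul_row y r a + tmul_row y r a'.
Proof.
rewrite /tmul_row /tens_lift -big_split /=; apply: eq_bigr => p _.
by rewrite mulrDl tensDr.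
Qed.
Let rowZ y c r a : tmul_row y (c *: r) a = tmul_row y r (c *: a).
Proof.
rewrite /tmul_row /tens_lift; apply: eq_bigr => p _.
by rewrite -!scalerAl tensZ.
Qed.

Lemma tmul_tens r a s b : tmul (tens r a) (tens s b) = tens (r * s) (a * b).
Proof.
rewrite /tmul tens_lift_tens ?tens_lift_tens //; 
  [exact: rowDl|exact: rowDr|exact: rowZ].
Qed.

Fact tmulDl : left_distributive tmul +%R.
Proof.
move=> x y z; rewrite /tmul tens_liftD //;
  [exact: rowDl|exact: rowDr|exact: rowZ].
Qed.
Fact tmulDr : right_distributive tmul +%R.
Proof.
move=> x y z; rewrite /tmul /(tens_lift _ x) -big_split /=.
apply: eq_bigr => p _; apply: tens_liftD => *; [exact: mDl|exact: mDr|exact: mZ].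
Qed.
Let tmul0l x : tmul 0 x = 0.
Proof.
have /eqP := tmulDl 0 0 x.
by rewrite addr0 -subr_eq0 opprD addNKr oppr_eq0 => /eqP.
Qed.
Let tmul0r x : tmul x 0 = 0.
Proof.
have /eqP := tmulDr x 0 0.
by rewrite addr0 -subr_eq0 opprD addNKr oppr_eq0 => /eqP.
Qed.

Fact tmulA : associative tmul.
Proof.
elim/tens_ind=> [y z|r a|x x' IH IH' y z]; first by rewrite !tmul0l.
  elim/tens_ind=> [z|s b|y y' IH IH' z]; first by rewrite !(tmul0l, tmul0r).
    elim/tens_ind=> [|t c|z z' IH IH']; first by rewrite !tmul0r.
      by rewrite !tmul_tens !mulrA.
    by rewrite !tmulDr IH IH'.
  by rewrite tmulDl !tmulDr tmulDl IH IH'.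
by rewrite !tmulDl IH IH'.
Qed.
Fact tmul1 : left_id (tens 1 1) tmul.
Proof.
elim/tens_ind=> [|r a|x x' IH IH']; first by rewrite tmul0r.
  by rewrite tmul_tens !mul1r.
by rewrite tmulDr IH IH'.
Qed.
Fact tmulr1 : right_id (tens 1 1) tmul.
Proof.
elim/tens_ind=> [|r a|x x' IH IH']; first by rewrite tmul0l.
  by rewrite tmul_tens !mulr1.
by rewrite tmulDl IH IH'.
Qed.

HB.instance Definition _ := GRing.Zmodule_isPzRing.Build tensor
  tmulA tmul1 tmulr1 tmulDl tmulDr.

Lemma tensM r a s b : tens r a * tens s b = tens (r * s) (a * b).
Proof. exact: tmul_tens. Qed.
Lemma tens11 : tens 1 1 = 1. Proof. by []. Qed.

Definition tscale (b : S) (x : tensor) : tensor := tens 1 b * x.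

Fact tscaleA a b x : tscale a (tscale b x) = tscale (a * b) x.
Proof. by rewrite /tscale mulrA tensM mulr1. Qed.
Fact tscale1 : left_id 1 tscale.
Proof. by move=> x; rewrite /tscale tens11 mul1r. Qed.
Fact tscaleDr : right_distributive tscale +%R.
Proof. by move=> b x y; rewrite /tscale mulrDr. Qed.
Fact tscaleDl x : {morph tscale^~ x : a b / a + b}.
Proof. by move=> a b; rewrite /tscale tensDr mulrDl. Qed.

HB.instance Definition _ := GRing.Zmodule_isLmodule.Build S tensor
  tscaleA tscale1 tscaleDr tscaleDl.

Lemma tscaleE b (x : tensor) : b *: x = tens 1 b * x. Proof. by []. Qed.

Lemma tscale_tens b r a : b *: tens r a = tens r (b * a).
Proof. by rewrite tscaleE tensM mul1r. Qed.

Lemma tscaleAl b (x y : tensor) : b *: (x * y) = (b *: x) * y.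
Proof. by rewrite !tscaleE mulrA. Qed.

Lemma tscaleAr b (x y : tensor) : b *: (x * y) = x * (b *: y).
Proof.
rewrite !tscaleE !mulrA; congr (_ * y).
elim/tens_ind: x => [|r a|x x' IH IH']; first by rewrite mulr0 mul0r.
  by rewrite !tensM mulr1 mul1r mulrC.
by rewrite mulrDl mulrDr IH IH'.
Qed.

End Tensor.

Section QuasiValuation.
Variables (F : fieldType) (G : ordZmodType) (v : valuation F G).
Variables (R : algType (Ov v)) (M : ordNmodType) (iota : ordEmbedding G M).

Definition quasi_valuation (T : pzRingType) (w : T -> withtop M) : Prop :=
  [/\ w 0 = oo,
      forall x y, w x + w y <=o w (x * y)
    & forall x y, omin (w x) (w y) <=o w (x + y)].

Record vQuasiVal := VQuasiVal {
  qv_fun :> R -> withtop M;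
  qvP : quasi_valuation qv_fun;
  qvZ : forall (c : Ov v) x, qv_fun (c *: x) = embtop iota (v (\val c)) + qv_fun x
}.

Inductive value_monoid (w : vQuasiVal) : set M :=
| value_monoid_gen x m : x != 0 -> w x = fin m -> value_monoid w m
| value_monoid0 : value_monoid w 0
| value_monoidD m n :
    value_monoid w m -> value_monoid w n -> value_monoid w (m + n).

(* R tensor F over O_v *)
Definition RF : Type := tensor R (fieldOf v).
HB.instance Definition _ := GRing.PzRing.on RF.
HB.instance Definition _ := GRing.Lmodule.on RF.

Definition frac (r : R) (b : Ov v) : RF := tens r ((\val b)^-1 : fieldOf v).

Lemma common_mult (d e : F) : d != 0 -> e != 0 ->
  exists a b : Ov v, [/\ \val a * d = \val b * e & \val a * d != 0].
Proof.
move=> d0 e0; have [gd vd] := val_fin v d0; have [ge ve] := val_fin v e0.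
have h x y gx gy : x != 0 -> v x = fin gx -> v y = fin gy -> gx <=o gy ->
    y / x \in Ov_pred v.
  move=> x0 vx vy le_xy; rewrite inE valM (valV vx) vy add_fin -fin0 le_fin.
  by rewrite -(subrr gx) oleD2r.
have /orP[le|le] := ole_total gd ge.
  exists (MkOv (h _ _ _ _ d0 vd ve le)), 1.
  by rewrite rmorph1 mul1r /= divfK.
exists 1, (MkOv (h _ _ _ _ e0 ve vd le)).
by rewrite rmorph1 mul1r /= divfK.
Qed.

Lemma inv_Ov (x : F) : exists2 d, d != 0 & d * x \in Ov_pred v.
Proof.
have [->|x0] := eqVneq x 0.
  by exists 1; rewrite ?oner_neq0 // inE mulr0 val0.
by exists x^-1; rewrite ?invr_eq0 // inE mulVf // val1 ole_refl.
Qed.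

Lemma fracD r s (b c : Ov v) : b != 0 -> c != 0 ->
  frac r b + frac s c = frac (c *: r + b *: s) (b * c).
Proof.
move=> b0 c0; rewrite /frac tensDl !tensZ !FO_scaleE rmorphM invfM.
by rewrite mulrCA mulfV ?Ov_val_eq0 // mulr1 mulrA mulfV ?Ov_val_eq0 // mul1r.
Qed.

Lemma fracM r s (b c : Ov v) : frac r b * frac s c = frac (r * s) (b * c).
Proof. by rewrite /frac tensM rmorphM invfM. Qed.

Lemma frac_tens (r : R) (x : fieldOf v) :
  exists p : R * Ov v, p.2 != 0 /\ tens r x = frac p.1 p.2.
Proof.
have [x0|x0] := eqVneq x 0.
  exists (0, 1); rewrite oner_neq0; split=> //.
  by rewrite x0 /frac -[in LHS](scale0r (1 : fieldOf v)) -tensZ scale0r !tens0l.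
have [a [b [ab ax]]] := common_mult (x0 : (x : F) != 0) (oner_neq0 F).
move: ab ax; rewrite mulr1 => ab ax.
have a0 : \val a != 0 by apply: contraNneq ax => ->; rewrite mul0r.
exists (b *: r, a); rewrite -Ov_val_eq0; split=> //=.
by rewrite /frac tensZ FO_scaleE /= -ab mulrC mulKf.
Qed.

Lemma fracP (x : RF) : exists p : R * Ov v, p.2 != 0 /\ x = frac p.1 p.2.
Proof.
elim/tens_ind: x => [|r x|x y [[r b] [/= b0 ->]] [[s c] [/= c0 ->]]].
- exists (0, 1); rewrite oner_neq0; split=> //; by rewrite /frac tens0l.
- exact: frac_tens.
- exists (c *: r + b *: s, b * c); split=> /=; last exact: fracD.
  by rewrite -Ov_val_eq0 rmorphM mulf_neq0 // Ov_val_eq0.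
Qed.

Let toO (x : F) : Ov v := insubd 0 x.

Let toOK x : x \in Ov_pred v -> \val (toO x) = x.
Proof. exact: insubdK. Qed.

Let cleared (d : F) (s : seq (R * fieldOf v)) :=
  all (fun p => d * p.2 \in Ov_pred v) s.
Let eval (d : F) (s : seq (R * fieldOf v)) : R := \sum_(p <- s) toO (d * p.2) *: p.1.

Let scaleOv (c : Ov v) (x : F) : x \in Ov_pred v -> \val c * x \in Ov_pred v.
Proof. by move=> xO; have [_ _ ->] := Ov_subring v; rewrite ?(valP c). Qed.

Let eval_scale (c : Ov v) d s : cleared d s ->
  cleared (\val c * d) s /\ eval (\val c * d) s = c *: eval d s.
Proof.
elim: s => [|p s IHs] /=; first by rewrite /eval !big_nil scaler0.
case/andP=> pO /IHs [cs es]; rewrite cs -mulrA scaleOv //; split=> //.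
rewrite /eval !big_cons scalerDr -!/(eval _ _) es scalerA; congr (_ *: _ + _).
by apply: val_inj; rewrite rmorphM /= !toOK ?scaleOv // -mulrA ?scaleOv.
Qed.

Let clearing s : exists2 d, d != 0 & cleared d s.
Proof.
elim: s => [|p s [d d0 ds]]; first by exists 1; rewrite ?oner_neq0.
have [e e0 ep] := inv_Ov p.2; have [a [b [ab ad0]]] := common_mult d0 e0.
exists (\val a * d) => //=; rewrite {1}ab -mulrA scaleOv //=.
by case: (eval_scale a ds).
Qed.

Let sameval s t := exists d, [/\ d != 0, cleared d s, cleared d t & eval d s = eval d t].

Let eval_cat d s t : eval d (s ++ t) = eval d s + eval d t.
Proof. by rewrite /eval big_cat. Qed.

Let tens_eq_sameval s t : tens_eq s t -> sameval s t.
Proof.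
elim=> {s t}.
- by move=> s; have [d d0 ds] := clearing s; exists d.
- by move=> s t _ [d [d0 ds dt e]]; exists d.
- move=> s t u _ [d [d0 ds dt e]] _ [d' [d'0 d't d'u e']].
  have [a [b [ab ad0]]] := common_mult d0 d'0; exists (\val a * d).
  have [cs es] := eval_scale a ds; have [ct et] := eval_scale a dt.
  have [ct' et'] := eval_scale b d't; have [cu eu] := eval_scale b d'u.
  by split=> //; [rewrite ab|rewrite es e -et ab et' e' -eu].
- move=> s s' t t' _ [d [d0 ds dt e]] _ [d' [d'0 d't d'u e']].
  have [a [b [ab ad0]]] := common_mult d0 d'0; exists (\val a * d).
  have [cs es] := eval_scale a ds; have [ct et] := eval_scale a dt.
  have [ct' et'] := eval_scale b d't; have [cu eu] := eval_scale b d'u.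
  split=> //; rewrite /cleared ?all_cat -?/(cleared _ _).
  + by rewrite cs ab.
  + by rewrite ct ab.
  + by rewrite !eval_cat es et e ab et' eu e'.
- move=> s t; have [d d0 dst] := clearing (s ++ t); exists d; split=> //.
    by move: dst; rewrite /cleared !all_cat andbC.
  by rewrite !eval_cat addrC.
- move=> x; have [d d0 dx] := inv_Ov x; exists d; split; rewrite /= ?dx //.
  by rewrite /eval big_seq1 big_nil scaler0.
- move=> r r' x; have [d d0 dx] := inv_Ov x; exists d; split; rewrite /= ?dx //.
  by rewrite /eval !big_cons big_nil !addr0 scalerDr.
- move=> r x x'; have [d d0 dx] := inv_Ov x; have [e e0 ex'] := inv_Ov x'.
  have [a [b [ab ad0]]] := common_mult d0 e0.
  have cx : \val a * d * x \in Ov_pred v by rewrite -mulrA scaleOv.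
  have cx' : \val a * d * x' \in Ov_pred v by rewrite ab -mulrA scaleOv.
  have cxx' : \val a * d * (x + x') \in Ov_pred v.
    rewrite mulrDr inE; apply: ole_trans (valD v _ _).
    by rewrite ole_omin; apply/andP.
  exists (\val a * d); split; rewrite /= ?cx ?cx' ?andbT //.
  rewrite /eval !big_cons big_nil !addr0 /= -scalerDl; congr (_ *: _).
  by apply: val_inj; rewrite rmorphD /= !toOK // mulrDr.
- move=> a r x; have [d d0 dx] := inv_Ov x.
  have cx : d * (\val a * (x : F)) \in Ov_pred v by rewrite mulrCA scaleOv.
  exists d; split; rewrite /= ?dx ?andbT //.
  rewrite /eval !big_seq1 /= scalerA; congr (_ *: _).
  by apply: val_inj; rewrite rmorphM /= !toOK // mulrC mulrCA.
Qed.

Lemma frac_eq r s (b c : Ov v) : b != 0 -> c != 0 -> frac r b = frac s c ->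
  exists a d : Ov v,
    [/\ a != 0, d != 0, \val a * \val b = \val d * \val c & a *: r = d *: s].
Proof.
move=> b0 c0 /class_ofP /tens_eq_sameval [d [d0]] /=; rewrite !andbT => db dc.
rewrite /eval !big_seq1 /= => e; exists (toO (d / \val b)), (toO (d / \val c)).
by rewrite -!Ov_val_eq0 !toOK // !mulf_neq0 ?invr_eq0 ?Ov_val_eq0 // !divfK ?Ov_val_eq0.
Qed.

(* W is computed on an arbitrary fraction representing x; natural_extE shows
   that the value does not depend on it. *)
Definition natural_ext (w : vQuasiVal) (x : RF) : withtop M :=
  let p := projT1 (cid (fracP x)) in subtop iota (w p.1) (v (\val p.2)).

Section NaturalExtension.
Variable w : vQuasiVal.
Local Notation W := (natural_ext w).

Lemma natural_extE r (b : Ov v) : b != 0 ->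
  W (frac r b) = subtop iota (w r) (v (\val b)).
Proof.
move=> b0; rewrite /natural_ext; case: cid => -[s c] /= [c0 eqf].
have [a [d [a0 d0 abdc ards]]] := frac_eq b0 c0 eqf.
have [gb vb] := Ov_fin b0; have [gc vc] := Ov_fin c0.
have [ga va] := Ov_fin a0; have [gd vd] := Ov_fin d0.
have := congr1 w ards; rewrite !qvZ va vd vb vc => ew.
have := congr1 v abdc; rewrite !valM va vb vc vd !add_fin => -[eg].
by rewrite -(embtop_shift _ _ gd) -[RHS](embtop_shift _ _ ga) eg ew.
Qed.

Lemma natural_ext_quasi : quasi_valuation W.
Proof.
have mulb (b c : Ov v) : b != 0 -> c != 0 -> b * c != 0.
  by rewrite -!Ov_val_eq0 rmorphM => b0 c0; rewrite mulf_neq0.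
split=> [|x y|x y].
- rewrite -[0](tens0l _ ((\val (1 : Ov v))^-1 : fieldOf v)) natural_extE ?oner_neq0 //.
  by have [-> _ _] := qvP w; rewrite val1.
- have [[r b] [/= b0 ->]] := fracP x; have [[s c] [/= c0 ->]] := fracP y.
  have [_ wM _] := qvP w.
  rewrite fracM !natural_extE ?mulb // rmorphM valM.
  have [gb ->] := Ov_fin b0; have [gc ->] := Ov_fin c0.
  rewrite add_fin !subtopE opprD raddfD -add_fin addrACA; exact: oleD2r.
- have [[r b] [/= b0 ->]] := fracP x; have [[s c] [/= c0 ->]] := fracP y.
  have [_ _ wD] := qvP w.
  rewrite fracD // !natural_extE ?mulb // rmorphM valM.
  have [gb vb] := Ov_fin b0; have [gc vc] := Ov_fin c0.
  rewrite vb vc add_fin.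
  rewrite -(embtop_shift _ (w r) gc gb) -(embtop_shift _ (w s) gb gc).
  rewrite [gc + gb]addrC !subtopE -omin_add2r; apply: oleD2r.
  by have := wD (c *: r) (b *: s); rewrite !qvZ vb vc.
Qed.

Lemma natural_extZ (c : Ov v) (x : RF) :
  W ((\val c : fieldOf v) *: x) = embtop iota (v (\val c)) + W x.
Proof.
have [[r b] [/= b0 ->]] := fracP x.
have -> : (\val c : fieldOf v) *: frac r b = frac (c *: r) b.
  by rewrite /frac tensZ; exact: tscale_tens.
rewrite !natural_extE // qvZ; have [gb ->] := Ov_fin b0.
by rewrite !subtopE addrA.
Qed.

Lemma natural_extN x : W (- x) = W x.
Proof.
have -> : - x = (\val (- 1 : Ov v) : fieldOf v) *: x.
  by rewrite Ov_valN1; exact/esym/scaleN1r.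
by rewrite natural_extZ Ov_valN1 valN1 /embtop /= raddf0 add0r.
Qed.

Lemma natural_ext1 : W 1 = w 1.
Proof.
have -> : 1 = frac 1 1 by rewrite /frac rmorph1 invr1.
by rewrite natural_extE ?oner_neq0 // rmorph1 val1 subtopE oppr0 raddf0 addr0.
Qed.

Definition OW_pred : {pred RF} := [pred x | 0 <=o W x].

(* The hypothesis w 1 = 0 is a parameter of the type because O_W is a ring
   only under it. *)
Record OW (w1 : w 1 = 0) := MkOW { OW_val : RF; _ : OW_val \in OW_pred }.

Section OW.
Variable w1 : w 1 = 0.
Local Notation OW := (OW w1).

Fact OW_subring : subring_closed OW_pred.
Proof.
have [_ WM WD] := natural_ext_quasi.
split=> [|x y|x y]; rewrite !inE.
- by rewrite natural_ext1 w1 ole_refl.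
- move=> Wx Wy; apply: ole_trans (WD x (- y)).
  by rewrite ole_omin Wx natural_extN.
- by move=> Wx Wy; apply: ole_trans (WM x y); have := oleD Wx Wy; rewrite add0r.
Qed.

HB.instance Definition _ := [isSub for @OW_val w1].
HB.instance Definition _ := [Choice of OW by <:].
HB.instance Definition _ :=
  GRing.SubChoice_isSubPzRing.Build RF OW_pred OW OW_subring.

Fact OW_nonzero : 1 != 0 :> OW.
Proof.
apply/eqP => /(congr1 val); rewrite rmorph1 raddf0 => /(congr1 W).
by have [-> _ _] := natural_ext_quasi; rewrite natural_ext1 w1.
Qed.

HB.instance Definition _ := GRing.PzSemiRing_isNonZero.Build OW OW_nonzero.

Fact OW_scale_subproof (c : Ov v) (x : OW) :
  (\val c : fieldOf v) *: \val x \in OW_pred.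
Proof.
rewrite inE natural_extZ; have := oleD (embtop_ge0 iota (Ov_ge0 c)) (valP x).
by rewrite add0r.
Qed.

Definition OW_scale c x : OW := MkOW w1 (OW_scale_subproof c x).

Fact OW_scaleA a b x : OW_scale a (OW_scale b x) = OW_scale (a * b) x.
Proof. by apply: val_inj; rewrite /= scalerA. Qed.
Fact OW_scale1 : left_id 1 OW_scale.
Proof. by move=> x; apply: val_inj; rewrite /= scale1r. Qed.
Fact OW_scaleDr : right_distributive OW_scale +%R.
Proof. by move=> c x y; apply: val_inj; rewrite /= scalerDr. Qed.
Fact OW_scaleDl x : {morph OW_scale^~ x : a b / a + b}.
Proof. by move=> a b; apply: val_inj; rewrite /= scalerDl. Qed.

HB.instance Definition _ := GRing.Zmodule_isLmodule.Build (Ov v) OW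
  OW_scaleA OW_scale1 OW_scaleDr OW_scaleDl.

Fact OW_scaleAl (c : Ov v) (x y : OW) : c *: (x * y) = (c *: x) * y.
Proof. by apply: val_inj; exact: tscaleAl. Qed.
Fact OW_scaleAr (c : Ov v) (x y : OW) : c *: (x * y) = x * (c *: y).
Proof. by apply: val_inj; exact: tscaleAr. Qed.

HB.instance Definition _ := GRing.Lmodule_isLalgebra.Build (Ov v) OW OW_scaleAl.
HB.instance Definition _ := GRing.Lalgebra_isAlgebra.Build (Ov v) OW OW_scaleAr.

End OW.
End NaturalExtension.
End QuasiValuation.

Definition cancellative_on (M : ordNmodType) (N : set M) : Prop :=
  forall a b c, N a -> N b -> N c -> a + c = b + c -> a = b.

Definition torsion_free (A : comNzRingType) (R : lmodType A) : Prop :=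
  forall (c : A) (r : R), c *: r = 0 -> c = 0 \/ r = 0.

Definition finite_dim (K : fieldType) (V : lmodType K) : Prop :=
  exists n : nat, inhabited (Vector.axiom n V).
Arguments finite_dim : clear implicits.

Section Spec.
Variable T : pzRingType.

Definition two_sided_ideal (I : set T) : Prop :=
  [/\ I 0,
      forall x y, I x -> I y -> I (x + y),
      forall r x, I x -> I (r * x)
    & forall r x, I x -> I (x * r)].

(* IJ is the set of sums of products x * y, so IJ <= P if P has all of these. *)
Definition prime_ideal (P : set T) : Prop :=
  [/\ two_sided_ideal P,
      P <> [set: T]
    & forall I J, two_sided_ideal I -> two_sided_ideal J ->
        (forall x y, I x -> J y -> P (x * y)) -> I `<=` P \/ J `<=` P].

Definition Spec : set (set T) := [set P | prime_ideal P].

End Spec.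
Arguments Spec : clear implicits.

Definition chain_in (T : Type) (S C : set (set T)) : Prop :=
  C `<=` S /\ total_on C subset.

Definition maximal_chain (T : Type) (S C : set (set T)) : Prop :=
  chain_in S C /\ forall D, chain_in S D -> C `<=` D -> D = C.

Definition contraction (A : comNzRingType) (T : algType A) (Q : set T) : set A :=
  [set c | Q c%:A].

(* Main.v *)
From HB Require Import structures.
Require Import Defs.
From mathcomp Require Import all_boot all_order all_algebra.
From mathcomp Require Import boolp classical_sets functions.
Import GRing.Theory.
Local Open Scope ring_scope.
Local Open Scope classical_set_scope.

(** Write [A] for the ring of elements of nonnegative value in the natural
    extension, and [O] for the valuation ring. Injectivity on a chain is
    incomparability; surjectivity combines going up and going between.

    Going between ([going_between]) only uses that [O] is a valuation ring and
    is central. Given an ideal [U] from which scalars outside a prime [p] can be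
    cancelled and a prime [V] above [U + p A], the products of a scalar outside
    [p] and an element outside [V] form an m-system that misses [U + p A]. A
    prime that is maximal among the ideals above [U + p A] avoiding it lies
    between [U] and [V] and contracts to [p].

    Going up ([OW_sub1_rinv]) is where the quasi-valuation enters. If [c] has
    positive value then multiplication by [c *: r] strictly increases values,
    because the values of nonzero elements can be cancelled; hence [1 - c *: r]
    preserves values, cannot be a zero divisor, and by finite dimension has an
    inverse, whose value is [0]. So no proper ideal contains an element
    [1 - c *: r], and every proper ideal stays proper after adding [p A].

    Incomparability ([ideal_above_meets_scalars]) says that a nonzero ideal in a
    finite-dimensional prime algebra contains a nonzero scalar. Finite dimension
    is used in the form that any [n + 1] elements of [A] satisfy a linear
    relation over [O] with some coefficient equal to [1]; such a relation
    survives reduction modulo any prime, so no residue algebra and no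
    localization has to be formed. It bounds chains of annihilators modulo a
    prime. The scalar is then found from an element of the ideal with smallest
    annihilator among those whose square has the same annihilator: without a
    scalar in the ideal such an element could be improved, nil left ideals being
    excluded by Utumi's argument.

    Finally, for a prime [p] of [O] and a maximal chain, [going_between] is
    applied to the union of the members contracting into [p] and to the
    intersection of the other members, or to a prime supplied by going up if there
    are none. The prime obtained is comparable with the whole chain, hence belongs
    to it. *)

Set Implicit Arguments.
Unset Strict Implicit.
Unset Printing Implicit Defensive.

(** * Ideals and primes of a noncommutative ring *)

Section Ideals.
Variable T : pzRingType.
Implicit Types (I J P Q U V S : set T) (a b r x y : T).

Lemma two_sided_ideal0 : two_sided_ideal [set 0 : T].
Proof.
by split=> [|x y -> ->|r x ->|r x ->] //=; rewrite ?addr0 ?mulr0 ?mul0r.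
Qed.

Lemma idealN I x : two_sided_ideal I -> I x -> I (- x).
Proof. by case=> _ _ Il _ Ix; rewrite -mulN1r; exact: Il. Qed.

Lemma idealB I x y : two_sided_ideal I -> I x -> I y -> I (x - y).
Proof. by move=> idI Ix Iy; case: (idI) => _ ID _ _; apply: ID => //; exact: idealN. Qed.

Lemma ideal_addr_inv I x y : two_sided_ideal I -> I (x + y) -> I x -> I y.
Proof. by move=> idI Ixy Ix; have := idealB idI Ixy Ix; rewrite addrAC subrr add0r. Qed.

Lemma ideal_addl_inv I x y : two_sided_ideal I -> I (x + y) -> I y -> I x.
Proof. by rewrite addrC; exact: ideal_addr_inv. Qed.

Lemma ideal_sum I (n : nat) (f : 'I_n -> T) (p : pred 'I_n) :
  two_sided_ideal I -> (forall i, p i -> I (f i)) -> I (\sum_(i < n | p i) f i).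
Proof. by case=> I0 ID _ _ If; apply: big_ind. Qed.

Lemma ideal_proper I : two_sided_ideal I -> I <> [set: T] -> ~ I 1.
Proof.
case=> _ _ Il _ IT I1; apply: IT; apply/seteqP; split=> // x _.
by rewrite -(mulr1 x); exact: Il.
Qed.

(** The ideals used are [{x | x T J <= P}] and [{y | a T y <= P}]: they are
    two-sided, multiply into [P], and contain [a] and [b] respectively, which
    avoids describing the ideals generated by [a] and by [b]. *)
Lemma prime_ideal_mul P a b :
  prime_ideal P -> (forall r, P (a * r * b)) -> P a \/ P b.
Proof.
case=> -[P0 PD Pl Pr] _ primeP ab.
pose J := [set y | forall r, P (a * r * y)].
pose I := [set x | forall r y, J y -> P (x * r * y)].
have idJ : two_sided_ideal J.
  split=> [r|x y Jx Jy r|s x Jx r|s x Jx r] /=.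
  - by rewrite mulr0.
  - by rewrite mulrDr; exact: PD.
  - by rewrite mulrA -(mulrA a); exact: Jx.
  - by rewrite mulrA; exact/Pr/Jx.
have idI : two_sided_ideal I.
  split=> [r y _|x y Ix Iy r z Jz|s x Ix r y Jy|s x Ix r y Jy] /=.
  - by rewrite !mul0r.
  - by rewrite !mulrDl; apply: PD; [exact: Ix|exact: Iy].
  - by rewrite -!mulrA; apply: Pl; rewrite mulrA; exact: Ix.
  - by rewrite -(mulrA x); exact: Ix.
have [x y Ix Jy|IP|JP] := primeP I J idI idJ.
- by rewrite -(mulr1 x); exact: Ix.
- by left; apply: IP => r y Jy; exact: Jy.
- by right; exact: JP.
Qed.

Lemma prime_ideal_of_mul P : two_sided_ideal P -> ~ P 1 ->
  (forall a b, (forall r, P (a * r * b)) -> P a \/ P b) -> prime_ideal P.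
Proof.
move=> idP P1 primeP; split=> // [PT|I J idI idJ IJP].
  by apply: P1; rewrite PT.
have [IP|/nonsubset[a [Ia Pa]]] := pselect (I `<=` P); first by left.
right=> b Jb; have [r||//] := primeP a b; last by move/Pa.
by rewrite -mulrA; apply: IJP => //; case: idJ => _ _ + _; exact.
Qed.

Lemma prime_ideal_proper P : prime_ideal P -> ~ P 1.
Proof. by case=> idP PT _; exact: ideal_proper. Qed.

(** Of two primes in the chain that miss [a] and [b], the smaller one misses
    both, hence misses some [a * r * b]. *)
Lemma prime_ideal_bigcap (D : set (set T)) :
  D !=set0 -> D `<=` Spec T -> total_on D subset ->
  prime_ideal [set x | forall P, D P -> P x].
Proof.
move=> [P0 DP0] Dprime Dtot.
have idD P : D P -> two_sided_ideal P by move/Dprime; case.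
apply: prime_ideal_of_mul => [|DI|a b abD].
- split=> [P /idD[]//|x y Dx Dy P DP|r x Dx P DP|r x Dx P DP];
    case: (idD P DP) => _ ID Il Ir.
  + by apply: ID; [exact: Dx|exact: Dy].
  + by apply: Il; exact: Dx.
  + by apply: Ir; exact: Dx.
- exact: (prime_ideal_proper (Dprime _ DP0) (DI _ DP0)).
apply: contrapT => /not_orP[/existsNP[P /not_implyP[DP Pa]]].
move=> /existsNP[Q /not_implyP[DQ Qb]].
wlog PQ : a b P Q DP DQ Pa Qb abD / P `<=` Q => [wlogPQ|].
  have [PQ|QP] := Dtot P Q DP DQ; first exact: (wlogPQ a b P Q).
  by case: (prime_ideal_mul (Dprime _ DQ) (fun r => abD r _ DQ)) => // /QP.
by case: (prime_ideal_mul (Dprime _ DP) (fun r => abD r _ DP)) => // /PQ.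
Qed.

Definition m_system S := forall a b, S a -> S b -> exists r, S (a * r * b).

(** Noncommutative Krull lemma: an ideal maximal among those above [I] that
    avoid the m-system [S] is prime, because two ideals properly above it both
    meet [S], and then so does their product. *)
Lemma exists_prime_avoiding I S :
  two_sided_ideal I -> m_system S -> S !=set0 -> (forall x, I x -> ~ S x) ->
  exists Q, [/\ prime_ideal Q, I `<=` Q & forall x, Q x -> ~ S x].
Proof.
move=> idI mS [s0 Ss0] IS.
pose good X := two_sided_ideal X /\ forall x, X x -> ~ S x.
(* adding I makes the property hold at the union of the empty chain *)
have [|A [[idA AS] maxA]] := @Zorn_bigcup T [set X | good (I `|` X)].
  move=> D Dgood Dtot /=; set U := I `|` _.
  have UP x y : U x -> U y ->
      exists X, [/\ good (I `|` X), (I `|` X) x, (I `|` X) y & I `|` X `<=` U].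
    have sub X : D X -> I `|` X `<=` U.
      by move=> DX z [Iz|Xz]; [left|right; exists X].
    move=> [Ix|[X DX Xx]] [Iy|[Y DY Yy]].
    - exists set0; split; [|by left|by left|by move=> z []//; left].
      by rewrite setU0; split.
    - by exists Y; split; [exact: Dgood|left|right|exact: sub].
    - by exists X; split; [exact: Dgood|right|left|exact: sub].
    - have [XY|YX] := Dtot _ _ DX DY.
        by exists Y; split; [exact: Dgood|right; exact: XY|right|exact: sub].
      by exists X; split; [exact: Dgood|right|right; exact: YX|exact: sub].
  split; last by move=> x Ux; have [X [[_ XS] Xx _ _]] := UP x x Ux Ux; exact: XS.
  split=> [|x y Ux Uy|r x Ux|r x Ux]; first by left; case: idI.
  - have [X [[[_ ID _ _] _] Xx Xy XU]] := UP x y Ux Uy; by apply/XU; exact: ID.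
  - by have [X [[[_ _ Il _] _] Xx _ XU]] := UP x x Ux Ux; exact/XU/Il.
  - by have [X [[[_ _ _ Ir] _] Xx _ XU]] := UP x x Ux Ux; exact/XU/Ir.
pose Q := I `|` A; have [Q0 QD Ql Qr] : two_sided_ideal Q by [].
exists Q; split=> //; last by move=> x Ix; left.
have meetS J : two_sided_ideal J -> ~ J `<=` Q ->
    exists q j, [/\ Q q, J j & S (q + j)].
  move=> [J0 JD Jl Jr] JQ; apply: contrapT => noS.
  pose B := [set z | exists q j, [/\ Q q, J j & z = q + j]].
  have QB : Q `<=` B by move=> q Qq; exists q, 0; rewrite addr0.
  have JB : J `<=` B by move=> j Jj; exists 0, j; rewrite add0r.
  have IB : I `|` B = B by apply/seteqP; split=> z; [case=> // Iz; apply: QB; left|right].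
  apply: (maxA B).
    split; first by move=> z Az; apply: QB; right.
    by move=> BA; apply: JQ => j Jj; right; exact/BA/JB.
  rewrite /= IB; split; last by move=> _ [q [j [Qq Jj ->]]] Sqj; apply: noS; exists q, j.
  split=> [|_ _ [q [j [Qq Jj ->]]] [q' [j' [Qq' Jj' ->]]]
          |r _ [q [j [Qq Jj ->]]]|r _ [q [j [Qq Jj ->]]]].
  - by apply: QB.
  - by exists (q + q'), (j + j'); split; [exact: QD|exact: JD|rewrite addrACA].
  - by exists (r * q), (r * j); split; [exact: Ql|exact: Jl|rewrite mulrDr].
  - by exists (q * r), (j * r); split; [exact: Qr|exact: Jr|rewrite mulrDl].
split=> // [QT|J K idJ idK JKQ]; first by apply: (AS s0); rewrite -/Q ?QT.
apply: contrapT => /not_orP[/meetS-/(_ idJ)[q [j [Qq Jj Sj]]]].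
move=> /meetS-/(_ idK)[q' [k [Qq' Kk Sk]]].
have [r] := mS _ _ Sj Sk; apply: AS; rewrite -/Q.
rewrite mulrDr; apply: (QD); first exact: Ql.
rewrite !mulrDl; apply: QD; first exact/Qr/Qr.
by apply: JKQ => //; case: idJ => _ _ _; exact.
Qed.

End Ideals.

(** * Contraction of primes along a central homomorphism *)

Section Contraction.
Variables (A : comNzRingType) (T : algType A).
Implicit Types (I P Q U V : set T) (p : set A) (c d : A) (x y z : T).

Lemma idealZ I c x : two_sided_ideal I -> I x -> I (c *: x).
Proof. by case=> _ _ Il _ Ix; rewrite -mulr_algl; exact: Il. Qed.

Lemma contractionZ I c x : two_sided_ideal I -> contraction I c -> I (c *: x).
Proof. by case=> _ _ _ Ir Ic; rewrite -mulr_algl; exact: Ir. Qed.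

Lemma prime_ideal_scale Q c x :
  prime_ideal Q -> Q (c *: x) -> ~ contraction Q c -> Q x.
Proof.
move=> primeQ Qcx Qc; case: (primeQ) => -[_ _ Ql _] _ _.
have [r||//] := @prime_ideal_mul _ Q c%:A x primeQ; last by move/Qc.
by rewrite mulr_algl -scalerAl scalerAr; exact: Ql.
Qed.

Lemma prime_ideal_contraction Q : prime_ideal Q -> prime_ideal (contraction Q).
Proof.
move=> primeQ; case: (primeQ) => -[Q0 QD Ql Qr] _ _.
apply: prime_ideal_of_mul.
- split=> [|c d Qc Qd|r c Qc|r c Qc]; rewrite /contraction /=.
  + by rewrite scale0r.
  + by rewrite scalerDl; exact: QD.
  + by rewrite -scalerA -mulr_algl; exact: Ql.
  + by rewrite mulrC -scalerA -mulr_algl; exact: Ql.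
- by rewrite /contraction /= scale1r; exact: prime_ideal_proper.
move=> c d cd; apply: contrapT => /not_orP[Qc Qd]; apply: Qd.
apply: prime_ideal_scale primeQ _ Qc.
by have := cd 1; rewrite mulr1 /contraction /= scalerA.
Qed.

Lemma contraction_subset P Q : P `<=` Q -> contraction P `<=` contraction Q.
Proof. by move=> PQ c; exact: PQ. Qed.

Definition divisibility_total := forall c d : A,
  (exists e, c = d * e) \/ (exists e, d = c * e).

Hypothesis div_total : divisibility_total.

Lemma prime_dvd p c d : prime_ideal p -> p c -> ~ p d ->
  exists2 e, p e & c = d * e.
Proof.
move=> primep pc pd; case: (primep) => -[_ _ pl pr] _ _.
have [[e cde]|[e dce]] := div_total c d; last first.
  by case: pd; rewrite dce; exact: pr.
exists e => //; have [r||//] := @prime_ideal_mul _ p d e primep; last by move/pd.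
by rewrite -mulrA mulrCA -cde; exact: pl.
Qed.

Lemma prime_subset_total p q : prime_ideal p -> prime_ideal q ->
  p `<=` q \/ q `<=` p.
Proof.
move=> primep primeq; apply: contrapT => /not_orP[/nonsubset[c [pc qc]]] qp.
apply: qp => d qd; have [e _ ->] := prime_dvd primeq qd qc.
by case: primep => -[_ _ _ pr] _ _; exact: pr.
Qed.

(** As scalars are totally ordered by divisibility, one term [c *: r] is enough
    to describe [U + p T]. *)
Definition ideal_add_extension U p := [set z |
  exists u c r, [/\ U u, p c & z = u + c *: r]].

Lemma ideal_add_extensionP U p : two_sided_ideal U -> prime_ideal p ->
  two_sided_ideal (ideal_add_extension U p).
Proof.
move=> [U0 UD Ul Ur] [[p0 pD pl pr] _ _].
split=> [|_ _ [u [c [r [Uu pc ->]]]] [u' [c' [r' [Uu' pc' ->]]]]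
        |s _ [u [c [r [Uu pc ->]]]]|s _ [u [c [r [Uu pc ->]]]]].
- by exists 0, 0, 0; rewrite scaler0 addr0.
- have [[e ->]|[e ->]] := div_total c c'.
    exists (u + u'), c', (e *: r + r'); split=> //; first exact: UD.
    by rewrite scalerDr scalerA addrACA.
  exists (u + u'), c, (r + e *: r'); split=> //; first exact: UD.
  by rewrite scalerDr scalerA addrACA.
- by exists (s * u), c, (s * r); rewrite mulrDr scalerAr; split=> //; exact: Ul.
- by exists (u * s), c, (r * s); rewrite mulrDl scalerAl; split=> //; exact: Ur.
Qed.

(** Strong going between. The m-system of all [c *: y] with [c] outside [p]
    and [y] outside [V] misses [U + p T]: from [c *: y = u + d *: r] with [d]
    in [p], write [d = c * e] with [e] in [p]; then [y - e *: r] is in [U], so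
    [y] is in [U + p T], hence in [V]. A prime above [U + p T] that avoids this
    m-system contracts to exactly [p] (take [y = 1]) and is contained in [V]
    (take [c = 1]). *)
Lemma going_between U V p :
  two_sided_ideal U -> prime_ideal V -> prime_ideal p ->
  (forall c x, U (c *: x) -> ~ p c -> U x) -> ideal_add_extension U p `<=` V ->
  exists Q, [/\ prime_ideal Q, U `<=` Q, Q `<=` V & contraction Q = p].
Proof.
move=> idU primeV primep Usat UpV.
pose S := [set z | exists c y, [/\ ~ p c, ~ V y & z = c *: y]].
have p1 := prime_ideal_proper primep; have V1 := prime_ideal_proper primeV.
case: (primep) => -[p0 _ _ _] _ _; case: (idU) => U0 _ _ _.
have [|_ _ [c [y [pc Vy ->]]] [d [z [pd Vz ->]]]||_ [u [d [r [Uu pd ->]]]]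
      |Q [primeQ UpQ QS]] := @exists_prime_avoiding T (ideal_add_extension U p) S.
- exact: ideal_add_extensionP.
- apply: contrapT => noS.
  have [r|//|//] := @prime_ideal_mul _ V y z primeV.
  apply: contrapT => Vyrz; apply: noS; exists r, (c * d), (y * r * z).
  split=> //; last by rewrite -!scalerAl -scalerAr scalerA.
  move=> pcd; have [e|//|//] := @prime_ideal_mul _ p c d primep.
  by rewrite mulrAC; case: primep => -[_ _ _ pr] _ _; exact: pr.
- by exists 1, 1, 1; rewrite scale1r.
- move=> [c [y [pc Vy uy]]]; apply: Vy; apply: UpV.
  have [e pe de] := prime_dvd primep pd pc.
  exists (y - e *: r), e, r; rewrite subrK; split=> //.
  apply: Usat (pc); rewrite scalerBr scalerA -de -uy addrK //.
exists Q; split=> //.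
- by move=> u Uu; apply: UpQ; exists u, 0, 0; rewrite scaler0 addr0.
- move=> y Qy; apply: contrapT => Vy; apply: (QS y Qy).
  by exists 1, y; rewrite scale1r.
apply/seteqP; split=> c.
  by move=> Qc; apply: contrapT => pc; apply: (QS _ Qc); exists c, 1.
by move=> pc; apply: UpQ; exists 0, c, 1; rewrite add0r.
Qed.

End Contraction.

(** * Incomparability *)

Section LowestTerm.
Variables (A : comNzRingType) (T : algType A) (I : set T).
Hypothesis idI : two_sided_ideal I.

(** Modulo [I], the terms of [\sum_(i < n) c i *: x ^+ i] before the first
    coefficient outside [contraction I] vanish. *)
Lemma lowest_term (x : T) (n : nat) (c : nat -> A) :
  (exists2 i, (i < n)%N & ~ contraction I (c i)) ->
  exists j d g, ~ contraction I d /\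
    I (\sum_(i < n) c i *: x ^+ i - x ^+ j * (d%:A + x * g)).
Proof.
elim: n c => [c []//|n IHn c ci]; rewrite big_ord_recl expr0.
have shift : \sum_(i < n) c (bump 0 i) *: x ^+ bump 0 i =
    x * \sum_(i < n) c i.+1 *: x ^+ i.
  by rewrite mulr_sumr; apply: eq_bigr => i _; rewrite -scalerAr -exprS.
rewrite shift; have [Ic0|Ic0] := pselect (contraction I (c 0)); last first.
  exists 0%N, (c 0), (\sum_(i < n) c i.+1 *: x ^+ i); split=> //.
  by rewrite expr0 mul1r subrr; case: idI.
have [|j [d [g [Id Ig]]]] := IHn (fun i => c i.+1).
  by case: ci => -[//|i] lt_in Ici; exists i.
exists j.+1, d, g; split=> //.
rewrite exprS -mulrA -addrA -mulrBr; case: (idI) => _ ID Il _.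
by apply: ID => //; exact: Il.
Qed.

End LowestTerm.

Section Incomparability.
Variables (A : comNzRingType) (T : algType A) (Q : set T).
Hypothesis primeQ : prime_ideal Q.
Variable n : nat.
Hypothesis dependent : forall y : nat -> T, exists c : nat -> A,
  (exists2 i, (i < n)%N & ~ contraction Q (c i)) /\
  \sum_(i < n) c i *: y i = 0.

Let idQ : two_sided_ideal Q. Proof. by case: primeQ. Qed.
Let Ql r x : Q x -> Q (r * x). Proof. by case: idQ => _ _ + _; exact. Qed.
Let Qr r x : Q x -> Q (x * r). Proof. by case: idQ => _ _ _; exact. Qed.
Let QD x y : Q x -> Q y -> Q (x + y). Proof. by case: idQ => _ + _ _; exact. Qed.
Let Q1 : ~ Q 1. Proof. exact: prime_ideal_proper. Qed.

Definition ann_mod (a : T) : set T := [set b | Q (a * b)].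

(** Multiplying a dependence relation among the [b i] by the [a i] for which
    [i] is the first index with a coefficient outside [Q] leaves one term
    modulo [Q]. *)
Lemma triangular_bounded (a b : nat -> T) :
  (forall i, (i < n)%N -> ~ Q (a i * b i)) ->
  (forall i j, (i < j < n)%N -> Q (a i * b j)) -> False.
Proof.
move=> diag upper; have [c [[i0 lt_i0n Qci0] sum0]] := dependent b.
have exc : exists i, (i < n)%N && `[< ~ contraction Q (c i) >].
  by exists i0; rewrite lt_i0n; exact/asboolP.
case: (ex_minnP exc) => i /andP[lt_in /asboolP Qci] mini.
apply: (diag i lt_in); apply: prime_ideal_scale primeQ _ Qci.
have : Q (a i * \sum_(j < n) c j *: b j) by rewrite sum0 mulr0; case: idQ.
rewrite (bigD1 (Ordinal lt_in)) //= mulrDr -scalerAr => /ideal_addl_inv; apply=> //.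
rewrite mulr_sumr; apply: ideal_sum => // j; rewrite -val_eqE /= neq_ltn => /orP[lt_ji|lt_ij].
  apply: Ql; apply: contractionZ => //; apply: contrapT => Qcj.
  have := mini j; rewrite ltn_ord (asboolT Qcj) => /(_ isT).
  by rewrite leqNgt lt_ji.
by rewrite -scalerAr; apply: idealZ => //; apply: upper; rewrite lt_ij ltn_ord.
Qed.

Let proper_sequence (E : set T) (R : T -> T -> Prop) : E !=set0 ->
  (forall a, E a -> exists2 b, E b & R a b) ->
  exists u : nat -> T, forall k, E (u k) /\ R (u k) (u k.+1).
Proof.
move=> [a0 Ea0] ER.
have /choice[f fE] : forall a, exists b, E a -> E b /\ R a b.
  move=> a; have [Ea|nEa] := pselect (E a); last by exists a.
  by have [b Eb Rab] := ER a Ea; exists b.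
exists (fun k => iter k f a0) => k.
have Ek : E (iter k f a0) by elim: k => //= k /fE[].
by split=> //; case: (fE _ Ek).
Qed.

(** Strictly monotone sequences of annihilators modulo [Q] have bounded
    length, by the triangular patterns they produce; so extremal annihilators
    exist in every nonempty family. *)
Lemma exists_max_ann (E : set T) : E !=set0 ->
  exists2 a, E a & forall a', E a' -> ann_mod a `<=` ann_mod a' ->
    ann_mod a' `<=` ann_mod a.
Proof.
move=> E0; apply: contrapT => nomax.
pose R a a' := ann_mod a `<=` ann_mod a' /\ exists b, Q (a' * b) /\ ~ Q (a * b).
have [a Ea|u uER] := @proper_sequence E R E0.
  apply: contrapT => noR; apply: nomax; exists a => // a' Ea' aa'.
  move=> b Qb; apply: contrapT => Qab; apply: noR; exists a' => //.
  by split=> //; exists b.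
have /choice[b bP] : forall k, exists b, Q (u k.+1 * b) /\ ~ Q (u k * b).
  by move=> k; have [_ []] := uER k.
have incr j i : (j <= i)%N -> ann_mod (u j) `<=` ann_mod (u i).
  move=> /subnK<-; elim: (i - j)%N => [//|k IHk x /IHk].
  by rewrite addSn; have [_ [+ _]] := uER (k + j)%N; exact.
(* the pattern is triangular the other way round, so it is read backwards *)
apply: (@triangular_bounded (fun i => u (n - i)%N) (fun i => b (n - i)%N)).
  by move=> i _; case: (bP (n - i)%N).
move=> i j /andP[lt_ij lt_jn]; apply: (@incr (n - j).+1); last by case: (bP (n - j)%N).
by apply: ltn_sub2l => //; exact: ltn_trans lt_jn.
Qed.

Lemma exists_min_ann (E : set T) : E !=set0 ->
  exists2 a, E a & forall a', E a' -> ann_mod a' `<=` ann_mod a ->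
    ann_mod a `<=` ann_mod a'.
Proof.
move=> E0; apply: contrapT => nomin.
pose R a a' := ann_mod a' `<=` ann_mod a /\ exists b, Q (a * b) /\ ~ Q (a' * b).
have [a Ea|u uER] := @proper_sequence E R E0.
  apply: contrapT => noR; apply: nomin; exists a => // a' Ea' aa'.
  move=> b Qb; apply: contrapT => Qab; apply: noR; exists a' => //.
  by split=> //; exists b.
have /choice[b bP] : forall k, exists b, Q (u k * b) /\ ~ Q (u k.+1 * b).
  by move=> k; have [_ []] := uER k.
have decr j i : (j <= i)%N -> ann_mod (u i) `<=` ann_mod (u j).
  move=> /subnK<-; elim: (i - j)%N => [//|k IHk x Qx]; apply: IHk; move: x Qx.
  by rewrite addSn; have [_ []] := uER (k + j)%N.
apply: (@triangular_bounded (u \o S) b) => [i _|i j /andP[lt_ij _]].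
  by case: (bP i).
by apply: (@decr _ j) => //; case: (bP j).
Qed.

(** Utumi's argument: among the elements of [N] outside [Q] take [a] with
    largest annihilator. For any [u], the last power [t] of [u * a] outside
    [Q] has the same annihilator as [a], which therefore contains [u * a]. So
    [a T a <= Q], against primeness. *)
Lemma nil_left_ideal_sub (N : set T) :
  (forall r a, N a -> N (r * a)) -> (forall a, N a -> exists k, Q (a ^+ k)) ->
  N `<=` Q.
Proof.
move=> Nl nil; apply: contrapT => /nonsubset NQ.
have [a [Na Qa] maxa] := exists_max_ann NQ.
have [u|//|//] := @prime_ideal_mul _ Q a a primeQ.
rewrite -mulrA; have [Qua|Qua] := pselect (Q (u * a)); first exact: Ql.
have /nil[k0 Qk0] := Nl u a Na.
have exk : exists k, `[< Q ((u * a) ^+ k) >] by exists k0; exact/asboolP.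
case: (ex_minnP exk) => -[|[|k]] /asboolP.
- by rewrite expr0.
- by rewrite expr1.
move=> Qk mink; pose t := (u * a) ^+ k.+1.
have Qt : ~ Q t by move=> /asboolT/mink; rewrite ltnn.
have tE : t = (u * a) ^+ k * u * a by rewrite /t exprSr mulrA.
apply: (maxa t); first by split=> //; rewrite tE; exact: Nl.
  by move=> b Qab; rewrite /ann_mod /= tE -(mulrA _ a); apply: Ql; exact: Qab.
by rewrite /ann_mod /= -exprSr.
Qed.

Lemma ann_mod_expr x k : ann_mod (x * x) `<=` ann_mod x ->
  ann_mod (x ^+ k.+1) `<=` ann_mod x.
Proof.
move=> xx; elim: k => [|k IHk] b; first by rewrite expr1.
rewrite /ann_mod /= exprSr -mulrA => /IHk; rewrite /ann_mod /= mulrA.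
exact: xx.
Qed.

Lemma stable_power x :
  exists m, ann_mod (x ^+ m.+1 * x ^+ m.+1) `<=` ann_mod (x ^+ m.+1).
Proof.
have [|_ [m _ <-] maxm] := @exists_max_ann [set x ^+ m.+1 | m in [set: nat]].
  by exists (x ^+ 1), 0%N.
exists m; apply: maxm; first by exists (m + m.+1)%N => //; rewrite -exprD addSn.
by move=> b Qb; rewrite /ann_mod /= -mulrA; apply: Ql; exact: Qb.
Qed.

Lemma fitting x : ann_mod (x * x) `<=` ann_mod x ->
  exists d g, ~ contraction Q d /\ Q (x * (d%:A + x * g)).
Proof.
move=> xx; have [c [Qc sum0]] := dependent (fun i => x ^+ i).
have [j [d [g [Qd]]]] := lowest_term idQ x Qc.
rewrite sum0 sub0r => /(idealN idQ); rewrite opprK => Qxj; exists d, g.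
split=> //; apply: (ann_mod_expr (k := j) xx).
by rewrite /ann_mod /= exprS -mulrA; exact: Ql.
Qed.

(** A nonzero ideal of a finite-dimensional prime algebra contains [1]; here
    the algebra is [T / Q] with scalars outside [Q] inverted. Take [x] in [J],
    regular in the sense that its square has the same annihilator modulo [Q],
    with smallest annihilator. By [fitting] some [f = d + x * g] satisfies
    [x * f = 0] modulo [Q], and [f] is congruent modulo [J] to the scalar [d].
    If no scalar outside [Q] lay in [J], then [f] would be outside [Q], and so
    some [y * f] with [y] in [J] would not be nilpotent modulo [Q]. A power [z]
    of [f * y] is then regular, [x * z] is in [Q], and [x + z] is a regular
    element of [J] with smaller annihilator than [x]. *)
Lemma ideal_above_meets_scalars (J : set T) : two_sided_ideal J ->
  Q `<=` J -> ~ J `<=` Q -> exists c, contraction J c /\ ~ contraction Q c.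
Proof.
move=> idJ QJ JQ; apply: contrapT => noc; case: (idJ) => J0 JD Jl Jr.
pose E := [set x | J x /\ ann_mod (x * x) `<=` ann_mod x].
have [|x [Jx xx] minx] := @exists_min_ann E.
  by exists 0; split=> // b _; rewrite /ann_mod /= mul0r; case: idQ.
have [d [g [Qd Qxf]]] := fitting xx; set f := _ + _ in Qxf.
have Qf : ~ Q f.
  move=> Qf; apply: noc; exists d; split=> //.
  by apply: (@ideal_addl_inv _ J _ (x * g)) => //; [exact: QJ|exact: Jr].
have [y Jy nonnil] : exists2 y, J y & forall k, ~ Q ((y * f) ^+ k).
  apply: contrapT => nil; apply: JQ => y Jy.
  have [r|//|//] := @prime_ideal_mul _ Q y f primeQ.
  apply: (@nil_left_ideal_sub [set y * f | y in J]) => [s _ [t Jt <-]|_ [t Jt <-]|].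
  - by exists (s * t); [exact: Jl|rewrite mulrA].
  - by apply: contrapT => nnil; apply: nil; exists t => // k Qk; apply: nnil; exists k.
  - by exists (y * r) => //; exact: Jr.
have nonnil' k : ~ Q ((f * y) ^+ k).
  suff swap : y * (f * y) ^+ k * f = (y * f) ^+ k.+1.
    by move=> Qk; apply: (nonnil k.+1); rewrite -swap; apply/Qr/Ql.
  elim: k => [|k IHk]; first by rewrite expr0 mulr1 expr1.
  by rewrite exprS [RHS]exprS -IHk !mulrA.
have [m] := stable_power (f * y); set z := _ ^+ m.+1 => zz.
have Jz : J z by rewrite /z exprS; apply/Jr/Jl.
have Qxz : Q (x * z) by rewrite /z exprS -mulrA mulrA; exact: Qr.
have Qzz : ~ Q (z * z) by rewrite /z -exprD; exact: nonnil'.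
(* x * (x + z) and x * x have the same annihilator modulo Q *)
have xxz b : Q (x * (x + z) * b) -> Q (x * b).
  by rewrite mulrDr mulrDl => /(ideal_addl_inv idQ)-/(_ (Qr _ Qxz))/xx.
have Exz : E (x + z).
  split=> [|b]; first exact: JD.
  rewrite /ann_mod /= -mulrA; set t := (x + z) * b => Qt.
  have Qxt : Q (x * t) by apply: xxz; rewrite -mulrA; exact: Ql.
  have Qxb : Q (x * b) by apply: xxz; rewrite -mulrA.
  rewrite /t mulrDl; apply: QD => //; apply: zz; rewrite /ann_mod /= -mulrA.
  move: Qt; rewrite mulrDl => /(ideal_addr_inv idQ)-/(_ Qxt).
  by rewrite /t mulrDl mulrDr => /(ideal_addr_inv idQ); apply; exact: Ql.
have annx : ann_mod (x + z) `<=` ann_mod x.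
  by move=> b Qb; apply: xxz; rewrite -mulrA; apply: Ql; exact: Qb.
have := minx _ Exz annx z Qxz.
by rewrite /ann_mod /= mulrDl => /(ideal_addr_inv idQ)/(_ Qxz).
Qed.

End Incomparability.

(** * Maximal chains of primes *)

Section MaximalChain.
Variables (A : comNzRingType) (T : algType A) (n : nat).
Hypothesis div_total : divisibility_total A.
Hypothesis T_tf : torsion_free T.
Hypothesis dependent : forall y : nat -> T, exists c : nat -> A,
  (exists2 i, (i < n)%N & c i = 1) /\ \sum_(i < n) c i *: y i = 0.
Hypothesis sub1_rinv : forall (p : set A) c (r : T), prime_ideal p -> p c ->
  exists z, (1 - c *: r) * z = 1.

Lemma incomparability (P Q : set T) : prime_ideal P -> prime_ideal Q ->
  P `<=` Q -> contraction P = contraction Q -> P = Q.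
Proof.
move=> primeP primeQ PQ PQc; apply/seteqP; split=> //; apply: contrapT => QP.
have dep (y : nat -> T) : exists c : nat -> A,
    (exists2 i, (i < n)%N & ~ contraction P (c i)) /\ \sum_(i < n) c i *: y i = 0.
  have [c [[i lt_in ci] sum0]] := dependent y; exists c; split=> //.
  exists i => //; rewrite ci /contraction /= scale1r; exact: prime_ideal_proper.
have [idQ _ _] := primeQ.
by have [c []] := ideal_above_meets_scalars primeP dep idQ PQ QP; rewrite PQc.
Qed.

Variable C : set (set T).
Hypothesis C_max : maximal_chain (Spec T) C.

Lemma maximal_chain_comparable Q : prime_ideal Q ->
  (forall P, C P -> P `<=` Q \/ Q `<=` P) -> C Q.
Proof.
move=> primeQ cmp; case: C_max => -[CS Ctot] maxC.
suff <- : C `|` [set Q] = C by right.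
apply: maxC; last by move=> P; left.
split=> [P [/CS//|->//]|P P' [CP|->] [CP'|->]]; first exact: Ctot.
- exact: cmp.
- by have [|] := cmp P' CP'; [right|left].
- by left.
Qed.

(** [U] is the union of the members of [C] contracting into [p] and [V] the
    intersection of the others, or any prime above [U + p T] when there are no
    others. [going_between] applies to them because membership of [c *: x] in
    [U] is decided in a single prime of the chain. *)
Lemma maximal_chain_over (p : set A) : prime_ideal p ->
  exists2 Q, C Q & contraction Q = p.
Proof.
move=> primep; case: (C_max) => -[CS Ctot] _.
have [[p0 _ _ _] _ _] := primep.
have idC P : C P -> two_sided_ideal P by move/CS; case.
pose C1 := [set P | C P /\ contraction P `<=` p].
pose C2 := [set P | C P /\ ~ contraction P `<=` p].
have C12 P P' : C1 P -> C2 P' -> P `<=` P'.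
  move=> [CP Pp] [CP' P'p]; have [//|P'P] := Ctot P P' CP CP'.
  by case: P'p; apply: subset_trans Pp; exact: contraction_subset.
(* 0 is added for the case in which no member of C contracts into p *)
pose U := [set x | x = 0 \/ exists2 P, C1 P & P x].
have UC1 P : C1 P -> P `<=` U by move=> C1P x Px; right; exists P.
have UI I x : two_sided_ideal I -> (forall P, C1 P -> P `<=` I) -> U x -> I x.
  by move=> [I0 _ _ _] C1I [->//|[P /C1I]]; exact.
have idU : two_sided_ideal U.
  split=> [|x y Ux Uy|r x [->|[P C1P Px]]|r x [->|[P C1P Px]]]; first by left.
  - case: Ux Uy => [->|[P C1P Px]]; first by rewrite add0r.
    case=> [->|[P' C1P' P'y]]; first by rewrite addr0; right; exists P.
    have [PP'|P'P] := Ctot P P' C1P.1 C1P'.1; right.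
      by exists P' => //; case: (idC _ C1P'.1) => _ ID _ _; apply: ID => //; exact: PP'.
    by exists P => //; case: (idC _ C1P.1) => _ ID _ _; apply: ID => //; exact: P'P.
  - by left; rewrite mulr0.
  - by right; exists P => //; case: (idC _ C1P.1) => _ _ Il _; exact: Il.
  - by left; rewrite mul0r.
  - by right; exists P => //; case: (idC _ C1P.1) => _ _ _ Ir; exact: Ir.
have U1 : ~ U 1.
  case=> [/eqP|[P [CP _]]]; first by rewrite oner_eq0.
  exact/prime_ideal_proper/CS.
have [V [primeV UpV VC2]] : exists V, [/\ prime_ideal V,
    ideal_add_extension U p `<=` V & forall P, C2 P -> V `<=` P].
  have [[P0 C2P0]|noC2] := pselect (C2 !=set0).
    exists [set x | forall P, C2 P -> P x]; split.
    - apply: prime_ideal_bigcap; first by exists P0.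
        by move=> P [/CS].
      by move=> P P' [CP _] [CP' _]; exact: Ctot.
    - move=> _ [u [c [r [Uu pc ->]]]] P C2P; have idP := idC _ C2P.1.
      case: (idP) => _ ID _ _; apply: ID.
        by apply: UI Uu => // P' C1P'; exact: C12.
      apply: contractionZ => //; case: (C2P) => CP Pp.
      have [//|pP] := prime_subset_total div_total (prime_ideal_contraction (CS _ CP)) primep.
      exact: pP.
    - by move=> P C2P x; exact.
  have [|||x Upx x1|V [primeV UpV _]] :=
    @exists_prime_avoiding T (ideal_add_extension U p) [set 1].
  - exact: ideal_add_extensionP.
  - by move=> _ _ -> ->; exists 1; rewrite /= !mulr1.
  - by exists 1.
  (* 1 = u + c *: r makes u right invertible *)
  - case: Upx => u [c [r [Uu pc xE]]]; have [z] := sub1_rinv r primep pc.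
    have -> : 1 - c *: r = u by rewrite -x1 xE addrK.
    move=> uz; apply: U1; rewrite -uz.
    by case: idU => _ _ _; exact.
  by exists V; split=> // P C2P; case: noC2; exists P.
have [|Q [primeQ UQ QV Qp]] := going_between div_total idU primeV primep _ UpV.
  move=> c x [/T_tf[->//|->]|[P C1P Pcx]] pc; first by left.
  right; exists P => //; apply: prime_ideal_scale (CS _ C1P.1) Pcx _.
  by move=> Pc; apply: pc; exact: C1P.2.
exists Q => //; apply: maximal_chain_comparable => // P CP.
have [Pp|Pp] := pselect (contraction P `<=` p).
  by left; apply: subset_trans UQ; exact: UC1.
by right; apply: subset_trans QV _; exact: VC2.
Qed.

Lemma maximal_chain_contraction_bij :
  set_bij C (Spec A) (@contraction A T).
Proof.
case: (C_max) => -[CS Ctot] _; split=> [P /CS|P Q|p primep].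
- exact: prime_ideal_contraction.
- rewrite !inE => CP CQ PQ; have [sPQ|sQP] := Ctot P Q CP CQ.
    by apply: incomparability => //; exact: CS.
  by apply/esym/incomparability => //; exact: CS.
- by have [Q CQ Qp] := maximal_chain_over primep; exists Q.
Qed.

End MaximalChain.

(** * Valuation rings *)

Lemma linear_dependence (K : fieldType) (L : lmodType K) (n : nat) :
  Vector.axiom n L -> forall y : nat -> L, exists c : nat -> K,
  (exists2 i, (i < n.+1)%N & c i != 0) /\ \sum_(i < n.+1) c i *: y i = 0.
Proof.
move=> [f linf bijf] y.
pose fl : {linear L -> 'rV[K]_n} :=
  HB.pack f (GRing.isLinear.Build _ _ _ _ f linf).
pose Y := \matrix_(i < n.+1) fl (y i).
have : ~~ row_free Y by rewrite /row_free neq_ltn ltnS rank_leq_col.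
rewrite -kermx_eq0 => /rowV0Pn[u /sub_kermxP uY u0].
exists (fun i => u 0 (inord i)); split.
  have /rV0Pn[i ui] := u0; exists i; first exact: ltn_ord.
  by rewrite inord_val.
apply: (bij_inj bijf); rewrite -[f]/(fl : _ -> _) raddf0 raddf_sum -[RHS]uY mulmx_sum_row.
by apply: eq_bigr => i _; rewrite rowK inord_val; exact: linearZ.
Qed.

Section ValuationRing.
Variables (F : fieldType) (G : ordZmodType) (v : valuation F G).
Local Notation "x <=o y" := (ole x y) (at level 70, no associativity).

Lemma Ov_div (x y : F) : y != 0 -> v y <=o v x -> x / y \in Ov_pred v.
Proof.
move=> y0 le_yx; have [g vy] := val_fin v y0; rewrite inE Defs.valM (valV vy).
by have := oleD2r (fin (- g)) _ _ le_yx; rewrite vy add_fin subrr.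
Qed.

Lemma Ov_divisibility_total : divisibility_total (Ov v).
Proof.
have div (c d : Ov v) : v (\val d) <=o v (\val c) -> exists e, c = d * e.
  have [->|d0 le_dc] := eqVneq d 0.
    rewrite raddf0 val0; case E: (v (\val c)) => [g|] // _; exists 0.
    by rewrite mul0r; apply/eqP; rewrite -Ov_val_eq0; exact/eqP/(val_eq_oo v).
  rewrite -Ov_val_eq0 in d0; exists (MkOv (Ov_div d0 le_dc)).
  by apply: val_inj; rewrite rmorphM /= mulrC divfK.
by move=> c d; have /orP[/div|/div] := ole_total (v (\val c)) (v (\val d)); [right|left].
Qed.

Lemma Ov_prime_pos (p : set (Ov v)) c : prime_ideal p -> p c ->
  ~ v (\val c) <=o 0.
Proof.
move=> primep pc le0; apply: (prime_ideal_proper primep).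
have c0 : \val c != 0 by apply/eqP => c0; move: le0; rewrite c0 val0.
have cV : (\val c)^-1 \in Ov_pred v.
  by rewrite -[_^-1]mul1r; apply: Ov_div => //; rewrite Defs.val1.
have -> : 1 = MkOv cV * c by apply: val_inj; rewrite rmorphM rmorph1 /= mulVf.
by case: primep => -[_ _ pl _] _ _; exact: pl.
Qed.

Lemma exists_min_val (n : nat) (c : nat -> F) :
  exists2 i, (i < n.+1)%N & forall j, (j < n.+1)%N -> v (c i) <=o v (c j).
Proof.
elim: n => [|n [i lt_in mini]].
  by exists 0%N => // -[|j] // _; exact: ole_refl.
have [le|le] := orP (ole_total (v (c i)) (v (c n.+1))).
  exists i; first exact: ltnW.
  by move=> j; rewrite ltnS leq_eqVlt => /predU1P[->//|]; exact: mini.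
exists n.+1 => // j; rewrite ltnS leq_eqVlt => /predU1P[->|/mini]; first exact: ole_refl.
exact: ole_trans.
Qed.

(** Dividing a linear relation by a coefficient of least value makes that
    coefficient [1] and the others integral. *)
Lemma integral_dependence (L : lmodType (fieldOf v)) (n : nat) :
  Vector.axiom n L -> forall y : nat -> L, exists c : nat -> Ov v,
  (exists2 i, (i < n.+1)%N & c i = 1) /\
  \sum_(i < n.+1) (\val (c i) : fieldOf v) *: y i = 0.
Proof.
move=> dimL y; have [k [[i0 lt_i0 ki0] sum0]] := linear_dependence dimL y.
have [i lt_i mini] := exists_min_val n k.
have ki : k i != 0.
  apply: contraNneq ki0 => ki; have := mini i0 lt_i0.
  by rewrite ki val0; case E: (v (k i0)) => // _; exact/eqP/(val_eq_oo v).
have kO j : (j < n.+1)%N -> \val (insubd (0 : Ov v) (k j / k i)) = k j / k i.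
  by move=> lt_j; apply: insubdK; apply: Ov_div => //; exact: mini.
exists (fun j => insubd (0 : Ov v) (k j / k i)); split.
  by exists i => //; apply: val_inj; rewrite kO // divff // rmorph1.
apply: (scalerI ki); rewrite scaler0 -[RHS]sum0 scaler_sumr.
by apply: eq_bigr => j _; rewrite kO // scalerA mulrC divfK.
Qed.

End ValuationRing.

(** * The ring of the natural extension *)

Section NaturalExtensionRing.
Variables (F : fieldType) (G : ordZmodType) (v : valuation F G).
Variables (R : algType (Ov v)) (M : ordNmodType) (iota : ordEmbedding G M).
Variable w : vQuasiVal R iota.
Hypothesis w1 : w 1 = 0.
Hypothesis w_fin : forall x : R, x != 0 -> w x <> oo.
Local Notation W := (natural_ext w).
Local Notation OW := (OW w1).
Local Notation "x <=o y" := (ole x y) (at level 70, no associativity).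

Lemma OW_valZ (c : Ov v) (x : OW) : \val (c *: x) = (\val c : fieldOf v) *: \val x.
Proof. by []. Qed.

Lemma OW_torsion_free : torsion_free OW.
Proof.
move=> c x /(congr1 val); rewrite OW_valZ raddf0 => /eqP.
rewrite (@scaler_eq0 (fieldOf v) (RF R)) => /orP[|] /eqP x0; [left|right];
  by apply: val_inj; rewrite raddf0.
Qed.

Lemma OW_dependence (n : nat) : Vector.axiom n (RF R) ->
  forall y : nat -> OW, exists c : nat -> Ov v,
  (exists2 i, (i < n.+1)%N & c i = 1) /\ \sum_(i < n.+1) c i *: y i = 0.
Proof.
move=> dimRF y.
have [c [ci sum0]] := integral_dependence dimRF (fun i => \val (y i)).
by exists c; split=> //; apply: val_inj; rewrite raddf_sum raddf0.
Qed.

Lemma W_fin (x : RF R) : x != 0 -> exists m, W x = fin m.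
Proof.
have [[r b] [/= b0 ->]] := fracP x; rewrite natural_extE //.
have [g ->] := Ov_fin b0; have [->|r0 _] := eqVneq r 0.
  by rewrite /Defs.frac tens0l eqxx.
have := w_fin r0; case: (w r) => [m|//] _.
by exists (m + iota (- g)).
Qed.

Hypothesis w_canc : cancellative_on (value_monoid w).

(** If [g] is the value of [c], then [iota g] is the [w]-value of [c%:A], so
    cancelling the value of a numerator of [x] from [iota g + W x = W x] would
    give [g = 0]. *)
Lemma W_scale_gt (c : Ov v) (x : RF R) : ~ v (\val c) <=o 0 -> x != 0 ->
  ~ embtop iota (v (\val c)) + W x <=o W x.
Proof.
move=> c_gt0 x0 le.
have [m Wx] := W_fin x0.
have eqW : embtop iota (v (\val c)) + W x = W x.
  apply: ole_anti; rewrite le /= -{1}[W x]add0r; apply: oleD2r.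
  exact/embtop_ge0/Ov_ge0.
have [|g vc] := @Ov_fin _ _ v c.
  by apply/eqP => c0; move: le; rewrite c0 raddf0 val0 Wx.
rewrite vc in eqW.
have [[r b] [/= b0 xE]] := fracP x; rewrite xE natural_extE // in eqW.
have [h vb] := Ov_fin b0; rewrite vb subtopE addrA in eqW.
have r0 : r != 0 by apply: contraNneq x0 => r0; rewrite xE r0 /Defs.frac tens0l.
case wr : (w r) eqW => [a|]; last by case: (w_fin r0).
move=> /(congr1 (fun z => z + fin (iota h))); rewrite -!addrA.
have -> : fin (iota (- h)) + fin (iota h) = 0 :> withtop M by rewrite addrC embtopK.
rewrite !addr0 /= => -[eqg].
have wc : w c%:A = fin (iota g) by rewrite qvZ w1 addr0 vc.
have c0 : c%:A != 0 :> R.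
  by apply/eqP => c0; move: wc; rewrite c0; have [-> _ _] := qvP w.
have g0 : iota g = 0.
  apply: (w_canc (c := a)); last by rewrite add0r.
  - exact: value_monoid_gen wc.
  - exact: value_monoid0.
  - exact: value_monoid_gen wr.
apply: c_gt0; rewrite vc -fin0 le_fin -(emb_mono iota) g0 raddf0.
exact: ole_refl.
Qed.

Lemma W_sub (x y : RF R) : omin (W x) (W y) <=o W (x - y).
Proof. by have [_ _ WD] := natural_ext_quasi w; rewrite -(natural_extN w y); exact: WD. Qed.

(** The subtracted term has value greater than [W t] by [W_scale_gt], and an
    element keeps its value when a term of greater value is subtracted. *)
Lemma W_perturb (c : Ov v) (r : OW) (t s : RF R) : ~ v (\val c) <=o 0 ->
  s = t - (\val c : fieldOf v) *: (\val r * t) -> W s = W t.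
Proof.
move=> c_gt0 ->; have [->|t0] := eqVneq t 0.
  by rewrite mulr0 scaler0 subr0.
set u := _ *: _; have [_ WM WD] := natural_ext_quasi w.
have le_tu : embtop iota (v (\val c)) + W t <=o W u.
  rewrite natural_extZ ![embtop _ _ + _]addrC; apply: oleD2r.
  by apply: ole_trans (WM _ _); have := oleD2r (W t) _ _ (valP r); rewrite add0r.
have lt_tu : ~ W u <=o W t.
  by move=> le_ut; apply: (W_scale_gt c_gt0 t0); exact: ole_trans le_tu le_ut.
have le_t_u : W t <=o W u by case/orP: (ole_total (W t) (W u)).
apply: ole_anti; apply/andP; split; last first.
  by apply: ole_trans (W_sub t u); rewrite ole_omin ole_refl.
by have := WD (t - u) u; rewrite subrK /omin; case: ifP.
Qed.

(** The element [y = 1 - c *: r] is left cancellable by [W_perturb], so the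
    lowest term of a linear relation among its powers gives [y * - g = d%:A] with
    [d <> 0]; by [W_perturb] again [- g] has the value of [d], and the inverse
    [- g / d] has value [0]. *)
Lemma OW_sub1_rinv (n : nat) (c : Ov v) (r : OW) : Vector.axiom n (RF R) ->
  ~ v (\val c) <=o 0 -> exists z : OW, (1 - c *: r) * z = 1.
Proof.
move=> dimRF c_gt0; set y := 1 - _.
have Wy (t : OW) : W (\val (y * t)) = W (\val t).
  apply: (W_perturb (r := r) c_gt0).
  rewrite /y mulrBl mul1r raddfB; congr (_ - _).
  by rewrite -scalerAl; congr (_ *: _); exact: rmorphM.
have ycan (t : OW) : y * t = 0 -> t = 0.
  move=> yt0; have := Wy t; rewrite yt0 raddf0; have [-> _ _] := natural_ext_quasi w.
  move=> Wt; apply: val_inj; rewrite raddf0; apply/eqP; apply: contraT => t0.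
  by have [m] := W_fin t0; rewrite -Wt.
have [a [[i lt_in ai] sum0]] := OW_dependence dimRF (fun i => y ^+ i).
have [|j [d [g [d0]]]] := @lowest_term _ _ [set 0 : OW] (two_sided_ideal0 _) y n.+1 a.
  by exists i => //; rewrite ai /contraction /= scale1r; apply/eqP; exact: oner_neq0.
rewrite sum0 sub0r /= => /eqP; rewrite oppr_eq0 => /eqP yj.
have {yj} ydg : d%:A + y * g = 0.
  elim: j yj => [|j IHj]; first by rewrite expr0 mul1r.
  by rewrite exprS -mulrA => /ycan.
have yg : y * - g = d%:A by rewrite mulrN; apply/eqP; rewrite eq_sym -addr_eq0 ydg.
have {}d0 : d != 0 by apply/eqP => d0'; apply: d0; rewrite d0' /contraction /= scale0r.
have Wg : W (\val (- g)) = embtop iota (v (\val d)).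
  by rewrite -Wy yg OW_valZ natural_extZ rmorph1 natural_ext1 w1 addr0.
pose z : RF R := ((\val d)^-1 : fieldOf v) *: \val (- g).
have dz : (\val d : fieldOf v) *: z = \val (- g).
  by rewrite /z scalerA mulfV ?scale1r // Ov_val_eq0.
have Wz : W z = 0.
  have := natural_extZ w d z; rewrite dz Wg; have [h ->] := Ov_fin d0.
  move=> /(congr1 (fun m => m + fin (iota (- h)))).
  by rewrite addrAC embtopK add0r.
have Oz : z \in OW_pred w by rewrite inE Wz; exact: ole_refl.
exists (MkOW w1 Oz); apply: val_inj; rewrite rmorphM rmorph1 /= /z -tscaleAr.
have := congr1 val yg; rewrite rmorphM OW_valZ rmorph1 => ->.
by rewrite scalerA mulVf ?scale1r // Ov_val_eq0.
Qed.

End NaturalExtensionRing.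

Theorem corollary4p20 (F : fieldType) (G : ordZmodType) (v : valuation F G)
    (v_nontrivial : exists x : F, x != 0 /\ v x <> 0)
    (R : algType (Ov v)) (R_tf : torsion_free R)
    (R_fin : finite_dim (fieldOf v) (RF R))
    (M : ordNmodType) (iota : ordEmbedding G M) (w : vQuasiVal R iota)
    (w1 : w 1 = 0) (w_fin : forall x : R, x != 0 -> w x <> oo)
    (w_canc : cancellative_on (value_monoid w))
    (C : set (set (OW w1))) (C_max : maximal_chain (Spec (OW w1)) C) :
  set_bij C (Spec (Ov v)) (@contraction _ (OW w1)) /\
  (forall P Q, C P -> C Q -> P `<=` Q -> contraction P `<=` contraction Q).
Proof.
split; last by move=> P Q _ _; exact: contraction_subset.
have [n [dimRF]] := R_fin.
apply: (@maximal_chain_contraction_bij _ _ n.+1) C_max.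
- exact: Ov_divisibility_total.
- exact: OW_torsion_free.
- exact: OW_dependence.
- move=> p c r primep pc; apply: (OW_sub1_rinv w_fin w_canc r dimRF).
  exact: Ov_prime_pos primep pc.
Qed.
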